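(* Let $\lambda$ be a nonzero dominant integral weight of $\mathfrak g$ and $V=V(\lambda)$. For each $i\in\mathbf I$, there is a unique element $\xi_i\in\mathbf U_{\mathrm R}^\lambda(\mathfrak g)$ with the property that $$\xi_i=\ell_{\mu+\alpha_i}^{-1}\ell_\mu\qquad\text{for all }\mu\in\mathsf\Lambda_{\lambda,i}.$$ Moreover, if $\mu$ is any weight of $V$ and $\lambda-\mu=\beta$ with $\beta=\sum_{j\in\mathbf I}n_j\alpha_j$, then $$\ell_\mu=\ell_\lambda\,\xi_\beta,\qquad\text{where}\quad\xi_\beta:=\prod_{j\in\mathbf I}\xi_j^{n_j}.$$
   Context: **Lie data.** $\mathfrak g$ is a complex simple Lie algebra with Cartan subalgebra $\mathfrak h$, simple roots $\{\alpha_i\}_{i\in\mathbf I}$ and invariant non-degenerate symmetric bilinear form $(\cdot,\cdot)$ normalized so that short simple roots have square length $2$; $d_i=(\alpha_i,\alpha_i)/2$, $a_{ij}=(\alpha_i,\alpha_j)/d_i$ (Cartan matrix), $q_i=q^{d_i}$. $\mathsf Q=\bigoplus_i\mathbb Z\alpha_i$ is the root lattice, $\mathsf Q_+=\bigoplus_i\mathbb Z_{\ge0}\alpha_i$, $\mathsf Q_-=-\mathsf Q_+$, and $\mathsf Q_+^\beta=\{\nu\in\mathsf Q_+:\beta-\nu\in\mathsf Q_+\}$. $\begin{bmatrix}n\\ r\end{bmatrix}_q=\frac{[n]_q!}{[r]_q![n-r]_q!}$ with $[m]_q=\frac{q^m-q^{-m}}{q-q^{-1}}$. **Quantum group.** $U_q(\mathfrak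 g)$ is the unital associative $\mathbb Q(q)$-algebra generated by $E_i,F_i$ ($i\in\mathbf I$), $K_\mu^{\pm1}$ ($\mu\in\mathsf Q$) with relations $K_\mu K_\gamma=K_{\mu+\gamma}$, $K_0=1$, $K_\mu E_jK_\mu^{-1}=q^{(\mu,\alpha_j)}E_j$, $K_\mu F_jK_\mu^{-1}=q^{-(\mu,\alpha_j)}F_j$, $[E_i,F_j]=\delta_{ij}\frac{K_{\alpha_i}-K_{-\alpha_i}}{q_i-q_i^{-1}}$, and for $i\neq j$ the $q$-Serre relations $\sum_{b=0}^{1-a_{ij}}(-1)^b\begin{bmatrix}1-a_{ij}\\ b\end{bmatrix}_{q_i}Z_i^bZ_jZ_i^{1-a_{ij}-b}=0$ for $Z=E$ and $Z=F$. With $K_i=K_{\alpha_i}$ its coproduct is $\Delta(K_\mu)=K_\mu\otimes K_\mu$, $\Delta(E_i)=E_i\otimes K_i+1\otimes E_i$, $\Delta(F_i)=F_i\otimes1+K_i^{-1}\otimes F_i$. It is $\mathsf Q$-graded: the degree $\beta$ part is $\{x:K_\mu xK_\mu^{-1}=q^{(\beta,\mu)}x\ \forall\mu\in\mathsf Q\}$. $U_q(\mathfrak n^+)$, $U_q(\mathfrak n^-)$ are the subalgebras generated by the $E_i$, resp. $F_i$; $U_q(\mathfrak b^\pm)$ is generated by $U_q(\mathfrak n^\pm)$ and the $K_\beta$. **The module $V$.** $V$ is the finite-dimensional irreducible type $1$ $U_q(\mathfrak g)$-module of highest weight $\lambda$, $\pi:U_q(\mathfrak g)\to\mathrm{End}(V)$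 its action, $V=\bigoplus_\mu V_\mu$ with $V_\mu=\{w:K_\beta w=q^{(\mu,\beta)}w\ \forall\beta\in\mathsf Q\}$, $\mathsf\Lambda_\lambda=\{\mu:V_\mu\ne0\}$, and $\mathsf\Lambda_{\lambda,i}=\{\mu\in\mathsf\Lambda_\lambda:\mu+\alpha_i\in\mathsf\Lambda_\lambda\}$ (non-empty). $\mathrm{End}(V)_\beta=\{X:X(V_\mu)\subset V_{\mu+\beta}\ \forall\mu\}$. For $T\in\mathrm{End}(V)\otimes\mathscr U$, $T_\beta$ is its component in $\mathrm{End}(V)_\beta\otimes\mathscr U$, and $T_1,T_2\in\mathrm{End}(V)^{\otimes2}\otimes\mathscr U$ denote $T$ placed in the first/second $\mathrm{End}(V)$-factor. **The $R$-matrix.** $\Psi$ is the automorphism of $U_q(\mathfrak g)^{\otimes2}$ fixing $K_i\otimes1$, $1\otimes K_i$, with $E_i\otimes1\mapsto E_i\otimes K_i^{-1}$, $F_i\otimes1\mapsto F_i\otimes K_i$, $1\otimes E_i\mapsto K_i^{-1}\otimes E_i$, $1\otimes F_i\mapsto K_i\otimes F_i$; $\Delta_\Psi=\Psi\circ\Delta$. $\{\mathscr R_\nu^+\}_{\nu\in\mathsf Q_+}$ is the unique family with $\mathscr R^+_\nu\in U_q(\mathfrak n^+)_\nu\otimes U_q(\mathfrak n^-)_{-\nu}$, $\mathscr R_0^+=1$ and, for all $\beta\in\mathsf Q_+$, $x\in U_q(\mathfrak b^+)$, $y\in U_q(\mathfrak b^-)$, $\sum_{\nu\in\mathsf Q_+^\beta}(\mathscr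 R_\nu^+\Delta(x)_{\beta-\nu}-\Delta_\Psi^{\mathrm{op}}(x)_{\beta-\nu}\mathscr R_\nu^+)=0=\sum_{\nu\in\mathsf Q_+^\beta}(\mathscr R_\nu^+\Delta(y)^{\nu-\beta}-\Delta_\Psi^{\mathrm{op}}(y)^{\nu-\beta}\mathscr R_\nu^+)$, where $u_\gamma$, $u^\gamma$ are the components of $u$ whose first, resp. second, tensor leg has degree $\gamma$ (for example $\mathscr R^+_{\alpha_i}=(q_i-q_i^{-1})E_i\otimes F_i$). $\mathscr R^+=\sum_\nu\mathscr R^+_\nu$ (only finitely many terms act nontrivially on a finite-dimensional module). $\mathscr D=\sum_{\mu,\gamma\in\mathsf\Lambda_\lambda}q^{(\mu,\gamma)-(\lambda,\lambda)}\mathrm{Id}_{V_\mu\otimes V_\gamma}$ and $\mathrm R=\mathscr D\cdot(\pi\otimes\pi)(\mathscr R^+)\in\mathrm{End}(V\otimes V)$. **The algebra $\mathbf U_{\mathrm R}^\lambda(\mathfrak g)$.** It is the unital associative $\mathbb Q(q)$-algebra generated by the coefficients of two matrices $\mathrm L^\pm\in\bigoplus_{\beta\in\mathsf Q_\pm}\mathrm{End}(V)_\beta\otimes\mathbf U_{\mathrm R}^\lambda(\mathfrak g)$ (that is, $\mathrm L^\pm=\sum_kX_k^\pm\otimes l_k^\pm$ with $\{X_k^\pm\}$ a basis of $\bigoplus_{\beta\in\mathsf Q_\pm}\mathrm{End}(V)_\beta$ and the $l_k^\pm$ the generators), subject to $\mathscr L^+\mathscr L^-=I=\mathscr L^-\mathscr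 L^+$ where $\mathscr L^\pm:=\mathrm L^\pm_0$, and $\mathrm R\mathrm L_1^+\mathrm L_2^-=\mathrm L_2^-\mathrm L_1^+\mathrm R$, $\mathrm R\mathrm L_1^\pm\mathrm L_2^\pm=\mathrm L_2^\pm\mathrm L_1^\pm\mathrm R$. For $\mu\in\mathsf\Lambda_\lambda$, $\ell_\mu\in\mathbf U_{\mathrm R}^\lambda(\mathfrak g)$ is the (unique, invertible) element such that $\mathscr L^+=\sum_{\mu\in\mathsf\Lambda_\lambda}\mathrm{Id}_{V_\mu}\otimes\ell_\mu$; the elements $\ell_\mu$ pairwise commute. *)

(* Defs.v *)
From HB Require Import structures.
From mathcomp Require Import all_boot all_order all_algebra.
From mathcomp Require Import finmap monalg mxtens.
From mathcomp Require Import boolp classical_sets cardinality fsbigop.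

Set Implicit Arguments.
Unset Strict Implicit.
Unset Printing Implicit Defensive.

Import Order.TTheory GRing.Theory Num.Theory.
Local Open Scope classical_set_scope.
Local Open Scope ring_scope.
Local Open Scope quotient_scope.

Section FreeAlgebra.
Context (K : comNzRingType).

Fact malg_scaleAr (M : monomType) (k : K) (x y : {malg K[M]}) :
  k *: (x * y) = x * (k *: y).
Proof.
apply/malgP => m; rewrite mcoeffZ (mcoeffMlw _ (fsubset_refl _) (fsubset_refl _)).
rewrite (mcoeffMlw _ (fsubset_refl _) (msuppZ_le k y)).
rewrite mulr_sumr; apply: eq_bigr => u _.
rewrite mulr_sumr; apply: eq_bigr => v _.
by rewrite mcoeffZ [in RHS]mulrCA mulrnAr.
Qed.

Context (X : choiceType).

Definition freealg : Type := {malg K[{fmonom X}]}.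
HB.instance Definition _ := GRing.Lalgebra.on freealg.
HB.instance Definition _ := GRing.Lalgebra_isAlgebra.Build K freealg (@malg_scaleAr _).

Definition fgen (x : X) : freealg := mkmalgU (fmu x) 1.

End FreeAlgebra.

Section QuotientAlgebra.
Context (K : comNzRingType) (A : algType K) (S : set A).

Inductive ideal_gen : A -> Prop :=
| ideal_gen0 : ideal_gen 0
| ideal_genD a s b x : S s -> ideal_gen x -> ideal_gen (a * s * b + x).

Lemma ideal_gen_add x y : ideal_gen x -> ideal_gen y -> ideal_gen (x + y).
Proof.
elim=> [|a s b z Ss _ IH] Iy; first by rewrite add0r.
by rewrite -addrA; apply: ideal_genD => //; apply: IH.
Qed.

Lemma ideal_gen_mul u v x : ideal_gen x -> ideal_gen (u * x * v).
Proof.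
elim=> [|a s b z Ss _ IH]; first by rewrite mulr0 mul0r; apply: ideal_gen0.
rewrite mulrDr mulrDl !mulrA -(mulrA (u * a * s)).
exact: ideal_genD.
Qed.

Lemma ideal_gen_scale k x : ideal_gen x -> ideal_gen (k *: x).
Proof.
by move=> Ix; rewrite -[x]mul1r scalerAl -[_ * x]mulr1; apply: ideal_gen_mul.
Qed.

Lemma ideal_gen_opp x : ideal_gen x -> ideal_gen (- x).
Proof. by rewrite -scaleN1r; apply: ideal_gen_scale. Qed.

Definition ideal_eq (x y : A) : bool := `[< ideal_gen (x - y) >].

Fact ideal_eq_refl : reflexive ideal_eq.
Proof. by move=> x; apply/asboolP; rewrite subrr; apply: ideal_gen0. Qed.
Fact ideal_eq_sym : symmetric ideal_eq.
Proof.
by move=> x y; apply/asboolP/asboolP => /ideal_gen_opp; rewrite opprB.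
Qed.
Fact ideal_eq_trans : transitive ideal_eq.
Proof.
move=> y x z /asboolP Ixy /asboolP Iyz; apply/asboolP.
by rewrite -[x](subrK y) -addrA; apply: ideal_gen_add.
Qed.

Canonical ideal_equiv := EquivRel ideal_eq ideal_eq_refl ideal_eq_sym ideal_eq_trans.

Definition qalg : Type := {eq_quot ideal_equiv}.
HB.instance Definition _ := Choice.on qalg.
HB.instance Definition _ := EqQuotient.on qalg.

Lemma qalgP x y : reflect (ideal_gen (x - y)) (x == y %[mod qalg]).
Proof. by rewrite piE; apply: asboolP. Qed.

Definition qadd := lift_op2 qalg +%R.
Definition qopp := lift_op1 qalg -%R.
Definition qmul := lift_op2 qalg *%R.
Definition qscale (k : K) := lift_op1 qalg ( *:%R k).

Fact pi_qadd : {morph \pi_qalg : x y / x + y >-> qadd x y}.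
Proof.
move=> x y; unlock qadd; apply/eqP/qalgP.
rewrite opprD addrACA; apply: ideal_gen_add; apply/qalgP; by rewrite reprK.
Qed.
Fact pi_qopp : {morph \pi_qalg : x / - x >-> qopp x}.
Proof.
move=> x; unlock qopp; apply/eqP/qalgP.
by rewrite -opprD; apply: ideal_gen_opp; apply/qalgP; rewrite reprK.
Qed.
Fact pi_qscale k : {morph \pi_qalg : x / k *: x >-> qscale k x}.
Proof.
move=> x; unlock qscale; apply/eqP/qalgP.
by rewrite -scalerBr; apply: ideal_gen_scale; apply/qalgP; rewrite reprK.
Qed.
Fact pi_qmul : {morph \pi_qalg : x y / x * y >-> qmul x y}.
Proof.
move=> x y; unlock qmul; apply/eqP/qalgP.
set x' := repr _; set y' := repr _.
have -> : x * y - x' * y' = (x - x') * y + x' * (y - y').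
  by rewrite mulrBl mulrBr addrA subrK.
apply: ideal_gen_add.
  by rewrite -[_ * y]mul1r mulrA; apply: ideal_gen_mul; apply/qalgP; rewrite reprK.
by rewrite -[_ * (_ - _)]mulr1; apply: ideal_gen_mul; apply/qalgP; rewrite reprK.
Qed.

Fact qaddA : associative qadd.
Proof. by elim/quotW=> x; elim/quotW=> y; elim/quotW=> z; rewrite -!pi_qadd addrA. Qed.
Fact qaddC : commutative qadd.
Proof. by elim/quotW=> x; elim/quotW=> y; rewrite -!pi_qadd addrC. Qed.
Fact qadd0 : left_id (\pi_qalg 0) qadd.
Proof. by elim/quotW=> x; rewrite -!pi_qadd add0r. Qed.
Fact qaddN : left_inverse (\pi_qalg 0) qopp qadd.
Proof. by elim/quotW=> x; rewrite -pi_qopp -pi_qadd addNr. Qed.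
HB.instance Definition _ := GRing.isZmodule.Build qalg qaddA qaddC qadd0 qaddN.

Fact qmulA : associative qmul.
Proof. by elim/quotW=> x; elim/quotW=> y; elim/quotW=> z; rewrite -!pi_qmul mulrA. Qed.
Fact qmul1 : left_id (\pi_qalg 1) qmul.
Proof. by elim/quotW=> x; rewrite -!pi_qmul mul1r. Qed.
Fact qmulr1 : right_id (\pi_qalg 1) qmul.
Proof. by elim/quotW=> x; rewrite -!pi_qmul mulr1. Qed.
Fact qmulDl : left_distributive qmul +%R.
Proof.
elim/quotW=> x; elim/quotW=> y; elim/quotW=> z.
by rewrite -[_ + _]pi_qadd -!pi_qmul -[RHS]pi_qadd mulrDl.
Qed.
Fact qmulDr : right_distributive qmul +%R.
Proof.
elim/quotW=> x; elim/quotW=> y; elim/quotW=> z.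
by rewrite -[_ + _]pi_qadd -!pi_qmul -[RHS]pi_qadd mulrDr.
Qed.
HB.instance Definition _ :=
  GRing.Zmodule_isPzRing.Build qalg qmulA qmul1 qmulr1 qmulDl qmulDr.

Fact qscaleA a b x : qscale a (qscale b x) = qscale (a * b) x.
Proof. by elim/quotW: x => x; rewrite -!pi_qscale scalerA. Qed.
Fact qscale1 : left_id 1 qscale.
Proof. by elim/quotW=> x; rewrite -pi_qscale scale1r. Qed.
Fact qscaleDr : right_distributive qscale +%R.
Proof.
move=> a; elim/quotW=> x; elim/quotW=> y.
by rewrite -[_ + _]pi_qadd -!pi_qscale -[RHS]pi_qadd scalerDr.
Qed.
Fact qscaleDl x : {morph qscale^~ x : a b / a + b}.
Proof.
elim/quotW: x => x a b.
by rewrite -!pi_qscale -[RHS]pi_qadd scalerDl.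
Qed.
HB.instance Definition _ :=
  GRing.Zmodule_isLmodule.Build K qalg qscaleA qscale1 qscaleDr qscaleDl.

Definition qproj (x : A) : qalg := \pi_qalg x.

Fact qproj_zmod : zmod_morphism qproj.
Proof. by move=> x y; rewrite /qproj pi_qadd pi_qopp. Qed.
Fact qproj_monoid : monoid_morphism qproj.
Proof. by split=> // x y; rewrite /qproj pi_qmul. Qed.
Fact qproj_scalable : scalable qproj.
Proof. by move=> k x; rewrite /qproj pi_qscale. Qed.
HB.instance Definition _ := GRing.isZmodMorphism.Build A qalg qproj qproj_zmod.
HB.instance Definition _ := GRing.isMonoidMorphism.Build A qalg qproj qproj_monoid.
HB.instance Definition _ := GRing.isScalable.Build K A qalg *:%R qproj qproj_scalable.

Fact qalg_scaleAl (k : K) (x y : qalg) : k *: (x * y) = k *: x * y.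
Proof.
elim/quotW: x => x; elim/quotW: y => y.
by rewrite -!/(qproj _) -rmorphM -!linearZ -rmorphM scalerAl.
Qed.
Fact qalg_scaleAr (k : K) (x y : qalg) : k *: (x * y) = x * (k *: y).
Proof.
elim/quotW: x => x; elim/quotW: y => y.
by rewrite -!/(qproj _) -rmorphM -!linearZ -rmorphM scalerAr.
Qed.

End QuotientAlgebra.

Section Tensor.
Context (K : comNzRingType).

Section Module.
Context (A B : lmodType K).

(* Finite formal sums, [:: (a1, b1); ...; (an, bn)] standing for
   a1 (x) b1 + ... + an (x) bn. *)
Inductive tens_rel : seq (A * B) -> seq (A * B) -> Prop :=
| tens_refl s : tens_rel s s
| tens_sym s t : tens_rel s t -> tens_rel t s
| tens_trans t s u : tens_rel s t -> tens_rel t u -> tens_rel s u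
| tens_cat s s' t t' : tens_rel s s' -> tens_rel t t' ->
    tens_rel (s ++ t) (s' ++ t')
| tens_comm s t : tens_rel (s ++ t) (t ++ s)
| tens_zero : tens_rel [:: (0, 0)] [::]
| tens_addl a a' b : tens_rel [:: (a + a', b)] [:: (a, b); (a', b)]
| tens_addr a b b' : tens_rel [:: (a, b + b')] [:: (a, b); (a, b')]
| tens_scale k a b : tens_rel [:: (k *: a, b)] [:: (a, k *: b)].

Definition tens_eq (s t : seq (A * B)) : bool := `[< tens_rel s t >].

Fact tens_eq_refl : reflexive tens_eq.
Proof. by move=> x; apply/asboolP; exact: tens_refl. Qed.
Fact tens_eq_sym : symmetric tens_eq.
Proof. by move=> x y; apply/asboolP/asboolP; exact: tens_sym. Qed.
Fact tens_eq_trans : transitive tens_eq.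
Proof.
by move=> y x z /asboolP xy /asboolP yz; apply/asboolP; apply: tens_trans xy yz.
Qed.

Canonical tens_equiv := EquivRel tens_eq tens_eq_refl tens_eq_sym tens_eq_trans.

Definition tens : Type := {eq_quot tens_equiv}.
HB.instance Definition _ := Choice.on tens.
HB.instance Definition _ := EqQuotient.on tens.

Lemma tensP s t : reflect (tens_rel s t) (s == t %[mod tens]).
Proof. by rewrite piE; apply: asboolP. Qed.

Lemma tens_repr s : tens_rel s (repr (\pi_tens s)).
Proof. by apply/tensP; rewrite reprK. Qed.

Definition tens_opp_seq (s : seq (A * B)) := [seq (- p.1, p.2) | p <- s].
Definition tens_scale_seq (k : K) (s : seq (A * B)) := [seq (k *: p.1, p.2) | p <- s].

Lemma tens_rel0l b : tens_rel [:: (0, b)] [::].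
Proof.
rewrite -{1}[0](scale0r 0); apply: tens_trans (tens_scale _ _ _) _.
by rewrite scale0r; exact: tens_zero.
Qed.

Lemma tens_scale_rel k s t : tens_rel s t ->
  tens_rel (tens_scale_seq k s) (tens_scale_seq k t).
Proof.
elim=> {s t}.
- by move=> s; exact: tens_refl.
- by move=> s t _; exact: tens_sym.
- by move=> t s u _ st _ tu; apply: tens_trans st tu.
- by move=> s s' t t' _ Hs _ Ht; rewrite /tens_scale_seq !map_cat; exact: tens_cat.
- by move=> s t; rewrite /tens_scale_seq !map_cat; exact: tens_comm.
- by rewrite /= scaler0; exact: tens_zero.
- by move=> a a' b; rewrite /= scalerDr; exact: tens_addl.
- by move=> a b b'; exact: tens_addr.
- move=> l a b /=; rewrite scalerA mulrC -scalerA; exact: tens_scale.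
Qed.

Lemma tens_oppE s : tens_opp_seq s = tens_scale_seq (-1) s.
Proof. by apply: eq_map => p; rewrite scaleN1r. Qed.

Definition tadd := lift_op2 tens cat.
Definition topp := lift_op1 tens tens_opp_seq.
Definition tscale (k : K) := lift_op1 tens (tens_scale_seq k).

Fact pi_tadd : {morph \pi_tens : s t / s ++ t >-> tadd s t}.
Proof. by move=> s t; unlock tadd; apply/eqP/tensP; apply: tens_cat; exact: tens_repr. Qed.
Fact pi_tscale k : {morph \pi_tens : s / tens_scale_seq k s >-> tscale k s}.
Proof. by move=> s; unlock tscale; apply/eqP/tensP; apply: tens_scale_rel; exact: tens_repr. Qed.
Fact pi_topp : {morph \pi_tens : s / tens_opp_seq s >-> topp s}.
Proof.
move=> s; unlock topp; apply/eqP/tensP; rewrite !tens_oppE.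
by apply: tens_scale_rel; exact: tens_repr.
Qed.

Fact taddA : associative tadd.
Proof. by elim/quotW=> x; elim/quotW=> y; elim/quotW=> z; rewrite -!pi_tadd catA. Qed.
Fact taddC : commutative tadd.
Proof.
elim/quotW=> x; elim/quotW=> y; rewrite -!pi_tadd.
by apply/eqP/tensP; exact: tens_comm.
Qed.
Fact tadd0 : left_id (\pi_tens [::]) tadd.
Proof. by elim/quotW=> x; rewrite -!pi_tadd. Qed.
Fact taddN : left_inverse (\pi_tens [::]) topp tadd.
Proof.
elim/quotW=> s; rewrite -pi_topp -pi_tadd; apply/eqP/tensP.
elim: s => [|[a b] s IH]; first exact: tens_refl.
have H1 : tens_rel ([:: (- a, b); (a, b)] ++ (tens_opp_seq s ++ s)) [::].
  apply: (@tens_trans ([::] ++ [::])); last exact: tens_refl.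
  apply: tens_cat => //.
  apply: (@tens_trans [:: (- a + a, b)]); first exact/tens_sym/tens_addl.
  by rewrite addNr; exact: tens_rel0l.
apply: tens_trans H1.
apply: (@tens_cat [:: (- a, b)] [:: (- a, b)]); first exact: tens_refl.
apply: (@tens_trans ((tens_opp_seq s ++ [:: (a, b)]) ++ s)).
  by rewrite -catA; exact: tens_refl.
exact: (tens_cat (tens_comm _ [:: (a, b)]) (tens_refl s)).
Qed.
HB.instance Definition _ := GRing.isZmodule.Build tens taddA taddC tadd0 taddN.

Fact tscaleA a b x : tscale a (tscale b x) = tscale (a * b) x.
Proof.
elim/quotW: x => x; rewrite -!pi_tscale /tens_scale_seq -map_comp.
by congr (\pi_tens _); apply: eq_map => p /=; rewrite scalerA.
Qed.
Fact tscale1 : left_id 1 tscale.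
Proof.
elim/quotW=> x; rewrite -pi_tscale; congr (\pi_tens _).
by rewrite -[RHS]map_id; apply: eq_map => -[a b] /=; rewrite scale1r.
Qed.
Fact tscaleDr : right_distributive tscale +%R.
Proof.
move=> a; elim/quotW=> x; elim/quotW=> y.
by rewrite -[_ + _]pi_tadd -!pi_tscale -[RHS]pi_tadd /tens_scale_seq map_cat.
Qed.
Fact tscaleDl x : {morph tscale^~ x : a b / a + b}.
Proof.
elim/quotW: x => s a b; rewrite -!pi_tscale -[RHS]pi_tadd.
apply/eqP/tensP; elim: s => [|[c d] s IH]; first exact: tens_refl.
have H := tens_cat (tens_addl (a *: c) (b *: c) d) IH.
rewrite -scalerDl in H; apply: tens_trans H _.
apply: (@tens_cat [:: (a *: c, d)] [:: (a *: c, d)]); first exact: tens_refl.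
apply: (@tens_trans (([:: (b *: c, d)] ++ tens_scale_seq a s) ++ tens_scale_seq b s)).
  exact: tens_refl.
apply: (@tens_trans ((tens_scale_seq a s ++ [:: (b *: c, d)]) ++ tens_scale_seq b s)).
  exact: (tens_cat (tens_comm [:: (b *: c, d)] _) (tens_refl _)).
by rewrite -catA; exact: tens_refl.
Qed.
HB.instance Definition _ :=
  GRing.Zmodule_isLmodule.Build K tens tscaleA tscale1 tscaleDr tscaleDl.

Definition tpure (a : A) (b : B) : tens := \pi_tens [:: (a, b)].

Lemma tens_piE s : \pi_tens s = \sum_(p <- s) tpure p.1 p.2.
Proof.
elim: s => [|[a b] s IH]; first by rewrite big_nil.
by rewrite big_cons -IH -cat1s pi_tadd.
Qed.

Lemma tens_sumE (u : tens) : u = \sum_(p <- repr u) tpure p.1 p.2.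
Proof. by rewrite -tens_piE reprK. Qed.

Lemma tpureDl a a' b : tpure (a + a') b = tpure a b + tpure a' b.
Proof. by rewrite -[RHS]pi_tadd; apply/eqP/tensP; exact: tens_addl. Qed.
Lemma tpureDr a b b' : tpure a (b + b') = tpure a b + tpure a b'.
Proof. by rewrite -[RHS]pi_tadd; apply/eqP/tensP; exact: tens_addr. Qed.
Lemma tpureZl k a b : tpure (k *: a) b = k *: tpure a b.
Proof. by rewrite -[RHS]pi_tscale. Qed.
Lemma tpureZr k a b : tpure a (k *: b) = k *: tpure a b.
Proof. by rewrite -tpureZl; apply/esym/eqP/tensP; exact: tens_scale. Qed.

(* The linear map induced by a bilinear f; independent of the chosen
   representative (tlift_pi). *)
Definition tlift (W : lmodType K) (f : A -> B -> W) (u : tens) : W :=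
  \sum_(p <- repr u) f p.1 p.2.

Definition bilin (W : lmodType K) (f : A -> B -> W) :=
  (forall b, linear (f^~ b)) /\ (forall a, linear (f a)).

Lemma tens_rel_bilin (W : lmodType K) (f : A -> B -> W) s t :
  bilin f -> tens_rel s t ->
  \sum_(p <- s) f p.1 p.2 = \sum_(p <- t) f p.1 p.2.
Proof.
move=> [fl fr]; elim=> {s t}.
- by [].
- by move=> s t _ ->.
- by move=> t s u _ -> _ ->.
- by move=> s s' t t' _ Hs _ Ht; rewrite !big_cat Hs Ht.
- by move=> s t; rewrite !big_cat /= addrC.
- rewrite big_seq1 big_nil.
  have := fl 0 (-1) 0 0; rewrite scaler0 addr0 scaleN1r addNr; exact.
- move=> a a' b; rewrite big_seq1 big_cons big_seq1 /=.
  by have := fl b 1 a a'; rewrite !scale1r.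
- move=> a b b'; rewrite big_seq1 big_cons big_seq1 /=.
  by have := fr a 1 b b'; rewrite !scale1r.
- move=> k a b; rewrite !big_seq1 /=.
  have z1 b0 : f 0 b0 = 0.
    by have := fl b0 (-1) 0 0; rewrite scaler0 addr0 scaleN1r addNr.
  have z2 a0 : f a0 0 = 0.
    by have := fr a0 (-1) 0 0; rewrite scaler0 addr0 scaleN1r addNr.
  have := fl b k a 0; rewrite addr0 z1 addr0 => ->.
  by have := fr a k b 0; rewrite addr0 z2 addr0 => ->.
Qed.

Lemma tlift_pi (W : lmodType K) (f : A -> B -> W) s :
  bilin f -> tlift f (\pi_tens s) = \sum_(p <- s) f p.1 p.2.
Proof. by move=> bf; apply/esym/tens_rel_bilin => //; exact: tens_repr. Qed.

Lemma tlift_pure (W : lmodType K) (f : A -> B -> W) a b :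
  bilin f -> tlift f (tpure a b) = f a b.
Proof. by move=> bf; rewrite /tpure tlift_pi // big_seq1. Qed.

Lemma tlift_linear (W : lmodType K) (f : A -> B -> W) :
  bilin f -> linear (tlift f).
Proof.
move=> bf k; elim/quotW=> s; elim/quotW=> t.
rewrite -[k *: _]pi_tscale -[_ + _]pi_tadd !tlift_pi // big_cat /=; congr (_ + _).
rewrite big_map /= scaler_sumr; apply: eq_bigr => p _.
have [fl _] := bf; have z b0 : f 0 b0 = 0.
  by have := fl b0 (-1) 0 0; rewrite scaler0 addr0 scaleN1r addNr.
by have := fl p.2 k p.1 0; rewrite addr0 z addr0.
Qed.

End Module.

Section Algebra.
Context (A B : algType K).

Definition tmul (u v : tens A B) : tens A B :=
  tlift (fun a b => tlift (fun a' b' => tpure (a * a') (b * b')) v) u.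

Lemma tmul_bilin1 a b :
  bilin (fun a' b' => tpure (a * a') (b * b') : tens A B).
Proof.
split=> [b' k x y|a' k x y].
  by rewrite mulrDr tpureDl -scalerAr tpureZl.
by rewrite mulrDr tpureDr -scalerAr tpureZr.
Qed.

Lemma tmul_bilin2 (v : tens A B) :
  bilin (fun a b => tlift (fun a' b' => tpure (a * a') (b * b')) v).
Proof.
elim/quotW: v => s; split=> [b|a] k x y.
  rewrite !(tlift_pi _ (tmul_bilin1 _ _)) scaler_sumr -big_split /=.
  by apply: eq_bigr => p _; rewrite mulrDl tpureDl -scalerAl tpureZl.
rewrite !(tlift_pi _ (tmul_bilin1 _ _)) scaler_sumr -big_split /=.
by apply: eq_bigr => p _; rewrite mulrDl tpureDr -scalerAl tpureZr.
Qed.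

Lemma tmul_pure a b a' b' :
  tmul (tpure a b) (tpure a' b') = tpure (a * a') (b * b').
Proof.
by rewrite /tmul (tlift_pure _ _ (tmul_bilin2 _)) (tlift_pure _ _ (tmul_bilin1 _ _)).
Qed.

Fact tmulDl : left_distributive tmul +%R.
Proof.
move=> x y z; have := tlift_linear (tmul_bilin2 z) 1 x y.
by rewrite !scale1r.
Qed.
Fact tmulDr : right_distributive tmul +%R.
Proof.
move=> x y z; rewrite /tmul /tlift -big_split; apply: eq_bigr => p _ /=.
by have := tlift_linear (tmul_bilin1 p.1 p.2) 1 y z; rewrite !scale1r.
Qed.
Lemma tmul0 x : tmul 0 x = 0.
Proof. by have /eqP := tmulDl 0 0 x; rewrite addr0 -subr_eq subrr => /eqP <-. Qed.
Lemma tmulr0 x : tmul x 0 = 0.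
Proof. by have /eqP := tmulDr x 0 0; rewrite addr0 -subr_eq subrr => /eqP <-. Qed.

Lemma tens_ind (P : tens A B -> Prop) :
  P 0 -> (forall a b u, P u -> P (tpure a b + u)) -> forall u, P u.
Proof.
move=> P0 PD u; rewrite (tens_sumE u); elim: (repr u) => [|p s IH].
  by rewrite big_nil.
by rewrite big_cons; apply: PD.
Qed.

Fact tmulA : associative tmul.
Proof.
elim/tens_ind=> [|a b u IHu] y z; first by rewrite !tmul0.
rewrite !tmulDl IHu; congr (_ + _); move: z; elim/tens_ind: y => [|c d v IHv] z.
  by rewrite !(tmul0, tmulr0).
rewrite !(tmulDl, tmulDr) IHv; congr (_ + _); elim/tens_ind: z => [|e f w IHw].
  by rewrite !tmulr0.
by rewrite !tmulDr IHw !tmul_pure !mulrA.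
Qed.
Fact tmul1 : left_id (tpure 1 1) tmul.
Proof.
elim/tens_ind=> [|a b u IHu]; first by rewrite tmulr0.
by rewrite tmulDr IHu tmul_pure !mul1r.
Qed.
Fact tmulr1 : right_id (tpure 1 1) tmul.
Proof.
elim/tens_ind=> [|a b u IHu]; first by rewrite tmul0.
by rewrite tmulDl IHu tmul_pure !mulr1.
Qed.
HB.instance Definition _ :=
  GRing.Zmodule_isPzRing.Build (tens A B) tmulA tmul1 tmulr1 tmulDl tmulDr.

End Algebra.
End Tensor.

Definition tflip (K : comNzRingType) (A B : lmodType K) : tens A B -> tens B A :=
  tlift (fun a b => tpure b a).

(* Sums of pure tensors a (x) b with a in P and b in Q. *)
Definition tspan (K : comNzRingType) (A B : lmodType K) (P : set A) (Q : set B) :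
    set (tens A B) :=
  [set u | exists s : seq (A * B),
     (forall p, p \in s -> P p.1 /\ Q p.2) /\
     u = \sum_(p <- s) tpure p.1 p.2].

Inductive gen_subalg (K : comNzRingType) (A : algType K) (S : set A) : A -> Prop :=
| gen_subalg_gen x : S x -> gen_subalg S x
| gen_subalg1 : gen_subalg S 1
| gen_subalgZ k x : gen_subalg S x -> gen_subalg S (k *: x)
| gen_subalgD x y : gen_subalg S x -> gen_subalg S y -> gen_subalg S (x + y)
| gen_subalgM x y : gen_subalg S x -> gen_subalg S y -> gen_subalg S (x * y).

(* The two-sided inverse of x, with the default value 0 when x has none. *)
Definition ring_inv (A : pzRingType) (x : A) : A :=
  xget 0 [set y | x * y = 1 /\ y * x = 1].

(* A complex simple Lie algebra is encoded by its Cartan matrix a_ij together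
   with the half square lengths d_i of its simple roots. Such matrices are the
   indecomposable ones for which (d_i a_ij) is symmetric positive definite. *)
Definition symm_form (r : nat) (a : 'M[int]_r) (d : 'I_r -> nat)
    (x y : 'rV[rat]_r) : rat :=
  \sum_i \sum_j x 0 i * y 0 j * ((d i)%:Z * a i j)%:~R.

Record cartan_datum := CartanDatum {
  rank : nat;
  cartan : 'M[int]_rank;
  dlen : 'I_rank -> nat;
  cartan_diag : forall i, cartan i i = 2;
  cartan_offdiag : forall i j, i != j -> cartan i j <= 0;
  cartan_symm : forall i j,
    (dlen i)%:Z * cartan i j = (dlen j)%:Z * cartan j i;
  cartan_posdef : forall x : 'rV[rat]_rank,
    x != 0 -> 0 < symm_form cartan dlen x x;
  cartan_indec : forall J : {set 'I_rank}, J != finset.set0 -> J != finset.setT ->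
    exists i j, [/\ i \in J, j \notin J & cartan i j != 0];
  dlen_gt0 : forall i, (0 < dlen i)%N;
  dlen_short : exists i, dlen i = 1%N
}.

Definition Qq : fieldType := {fraction {poly rat}}.
Definition q : Qq := tofrac 'X.

(* q to the power x; only meaningful (and only used) for integral x. *)
Definition qpow (x : rat) : Qq := q ^ numq x.

Section QuantumIntegers.
Variable v : Qq.
Definition qint (m : nat) : Qq := (v ^+ m - v ^- m) / (v - v^-1).
Definition qfact (m : nat) : Qq := \prod_(1 <= k < m.+1) qint k.
Definition qbinom (m k : nat) : Qq := qfact m / (qfact k * qfact (m - k)).
End QuantumIntegers.

Section Lattices.
Variable D : cartan_datum.
Local Notation r := (rank D).

(* Weights are vectors of coordinates with respect to the simple roots: the
   root lattice is 'rV[int]_r, and 'rV[rat]_r contains the weight lattice. *)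
Definition rootQ (b : 'rV[int]_r) : 'rV[rat]_r := map_mx intr b.
Definition alpha (i : 'I_r) : 'rV[int]_r := delta_mx 0 i.
Definition form : 'rV[rat]_r -> 'rV[rat]_r -> rat := symm_form (cartan D) (@dlen D).
Definition qi (i : 'I_r) : Qq := q ^+ dlen i.

Definition Qplus : set 'rV[int]_r := [set b | forall i, 0 <= b 0 i].
Definition Qminus : set 'rV[int]_r := [set b | Qplus (- b)].
Definition Qplus_le (b : 'rV[int]_r) : set 'rV[int]_r :=
  [set nu | Qplus nu /\ Qplus (b - nu)].

Definition weight_lattice : set 'rV[rat]_r :=
  [set mu | forall i, form mu (rootQ (alpha i)) / (dlen i)%:R \is a Num.int].
Definition dominant (mu : 'rV[rat]_r) : Prop :=
  forall i, form mu (rootQ (alpha i)) / (dlen i)%:R \is a Num.nat.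

End Lattices.

Section QuantumGroup.
Variable D : cartan_datum.
Local Notation r := (rank D).

Definition uq_gens : choiceType := ('I_r + 'I_r + 'rV[int]_r)%type.
Definition fE (i : 'I_r) : freealg Qq uq_gens := fgen Qq (inl (inl i) : uq_gens).
Definition fF (i : 'I_r) : freealg Qq uq_gens := fgen Qq (inl (inr i) : uq_gens).
Definition fK (mu : 'rV[int]_r) : freealg Qq uq_gens := fgen Qq (inr mu : uq_gens).

Definition serre (Z : 'I_r -> freealg Qq uq_gens) (i j : 'I_r) :=
  let m := `|1 - cartan D i j|%N in
  \sum_(b < m.+1)
    ((-1) ^+ b * qbinom (qi i) m b) *: (Z i ^+ b * Z j * Z i ^+ (m - b)).

Inductive uq_rel : freealg Qq uq_gens -> Prop :=
| uq_K0 : uq_rel (fK 0 - 1)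
| uq_KK mu ga : uq_rel (fK mu * fK ga - fK (mu + ga))
| uq_KE mu j : uq_rel (fK mu * fE j * fK (- mu)
    - qpow (form (rootQ mu) (rootQ (alpha j))) *: fE j)
| uq_KF mu j : uq_rel (fK mu * fF j * fK (- mu)
    - qpow (- form (rootQ mu) (rootQ (alpha j))) *: fF j)
| uq_EF i j : uq_rel (fE i * fF j - fF j * fE i
    - ((i == j)%:R / (qi i - (qi i)^-1)) *: (fK (alpha i) - fK (- alpha i)))
| uq_serreE i j : i != j -> uq_rel (serre fE i j)
| uq_serreF i j : i != j -> uq_rel (serre fF i j).

Definition Uq : Type := qalg uq_rel.
HB.instance Definition _ := GRing.PzRing.on Uq.
HB.instance Definition _ := GRing.Lmodule.on Uq.

(* The counit, used to see that Uq is not the zero ring. *)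
Definition counit_gen (x : uq_gens) : Qq := if x is inr _ then 1 else 0.
Definition counit_mon (m : {fmonom uq_gens}) : Qq := \prod_(x <- m) counit_gen x.

Fact counit_mon_morph : mmorphism counit_mon.
Proof.
split=> [x y|]; rewrite /counit_mon ?fm1 ?big_nil //.
by rewrite fmM big_cat.
Qed.
HB.instance Definition _ :=
  isMultiplicative.Build {fmonom uq_gens} Qq counit_mon counit_mon_morph.

Definition counit : freealg Qq uq_gens -> Qq := mmap idfun counit_mon.

Lemma counit_fgen x : counit (fgen Qq x) = counit_gen x.
Proof. by rewrite /counit /fgen mmapU mul1r /counit_mon fmU big_seq1. Qed.

Lemma counitB : {morph counit : x y / x - y}.
Proof. exact: mmapB. Qed.
Lemma counitD : {morph counit : x y / x + y}.
Proof. exact: mmapD. Qed.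
Lemma counitM : {morph counit : x y / x * y}.
Proof. exact: (@mmap_is_multiplicative _ _ _ idfun counit_mon).1. Qed.
Lemma counit1 : counit 1 = 1.
Proof. exact: (@mmap_is_multiplicative _ _ _ idfun counit_mon).2. Qed.
Lemma counitZ k x : counit (k *: x) = k * counit x.
Proof. exact: (@mmapZ _ _ _ idfun counit_mon). Qed.

Lemma counit_rel x : uq_rel x -> counit x = 0.
Proof.
have serre0 Z i j : (forall k, counit (Z k) = 0) -> counit (serre Z i j) = 0.
  move=> Z0; rewrite /serre; elim/big_ind: _ => [|x1 x2|b _].
  - by rewrite -[0](subrr 1) counitB subrr.
  - by rewrite counitD => -> ->; rewrite addr0.
  - by rewrite counitZ !counitM Z0 mulr0 mul0r mulr0.
have eqB x1 x2 : counit x1 = counit x2 -> counit (x1 - x2) = 0.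
  by rewrite counitB => ->; rewrite subrr.
have cM0l x1 x2 : counit x1 = 0 -> counit (x1 * x2) = 0.
  by rewrite counitM => ->; rewrite mul0r.
have cM0r x1 x2 : counit x2 = 0 -> counit (x1 * x2) = 0.
  by rewrite counitM => ->; rewrite mulr0.
have cZ0 k x1 : counit x1 = 0 -> counit (k *: x1) = 0.
  by rewrite counitZ => ->; rewrite mulr0.
have E0 i : counit (fE i) = 0 by exact: counit_fgen.
have F0 i : counit (fF i) = 0 by exact: counit_fgen.
have K1 mu : counit (fK mu) = 1 by exact: counit_fgen.
case=> [|mu ga|mu j|mu j|i j|i j _|i j _].
- by apply/eqB; rewrite K1 counit1.
- by apply/eqB; rewrite counitM !K1 mulr1.
- by apply/eqB; rewrite cM0l ?cZ0 ?cM0r.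
- by apply/eqB; rewrite cM0l ?cZ0 ?cM0r.
- apply/eqB; transitivity (0 : Qq).
    by apply/eqB; transitivity (0 : Qq); [exact: cM0l | exact/esym/cM0l].
  by apply/esym/cZ0/eqB; rewrite !K1.
- exact: serre0.
- exact: serre0.
Qed.

Lemma ideal_gen_uq_proper : ~ ideal_gen uq_rel 1.
Proof.
have H x : ideal_gen uq_rel x -> counit x = 0.
  elim=> [|a s b y /counit_rel s0 _ y0].
    by rewrite -[0](subrr 1) counitB subrr.
  by rewrite counitD !counitM s0 y0 mulr0 mul0r addr0.
by move/H/eqP; rewrite counit1 oner_eq0.
Qed.

Fact Uq_nonzero : (1 : Uq) != 0.
Proof.
apply/eqP => /eqP; rewrite -[1]/(qproj uq_rel 1) -[0]/(qproj uq_rel 0).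
by move/qalgP; rewrite subr0; exact: ideal_gen_uq_proper.
Qed.
HB.instance Definition _ := GRing.PzSemiRing_isNonZero.Build Uq Uq_nonzero.
HB.instance Definition _ :=
  GRing.Lmodule_isLalgebra.Build Qq Uq (@qalg_scaleAl Qq _ uq_rel).
HB.instance Definition _ :=
  GRing.Lalgebra_isAlgebra.Build Qq Uq (@qalg_scaleAr Qq _ uq_rel).

Definition uE (i : 'I_r) : Uq := qproj uq_rel (fE i).
Definition uF (i : 'I_r) : Uq := qproj uq_rel (fF i).
Definition uK (mu : 'rV[int]_r) : Uq := qproj uq_rel (fK mu).

Definition Uq_nplus : set Uq := gen_subalg (range uE).
Definition Uq_nminus : set Uq := gen_subalg (range uF).
Definition Uq_bplus : set Uq := gen_subalg (range uE `|` range uK).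
Definition Uq_bminus : set Uq := gen_subalg (range uF `|` range uK).

Definition Uq_deg (b : 'rV[int]_r) : set Uq :=
  [set x | forall mu, uK mu * x * uK (- mu) = qpow (form (rootQ b) (rootQ mu)) *: x].

Definition UqUq : Type := tens Uq Uq.
HB.instance Definition _ := GRing.PzRing.on UqUq.
HB.instance Definition _ := GRing.Lmodule.on UqUq.

Definition is_coproduct (Delta : {rmorphism Uq -> UqUq}) : Prop :=
  [/\ scalable Delta,
      forall mu, Delta (uK mu) = tpure (uK mu) (uK mu),
      forall i, Delta (uE i) = tpure (uE i) (uK (alpha i)) + tpure 1 (uE i)
    & forall i, Delta (uF i) = tpure (uF i) 1 + tpure (uK (- alpha i)) (uF i)].

Definition is_Psi (Psi : {rmorphism UqUq -> UqUq}) : Prop :=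
  scalable Psi /\ bijective Psi /\
  forall i,
    [/\ Psi (tpure (uK (alpha i)) 1) = tpure (uK (alpha i)) 1 /\
        Psi (tpure 1 (uK (alpha i))) = tpure 1 (uK (alpha i)),
        Psi (tpure (uE i) 1) = tpure (uE i) (uK (- alpha i)),
        Psi (tpure (uF i) 1) = tpure (uF i) (uK (alpha i)),
        Psi (tpure 1 (uE i)) = tpure (uK (- alpha i)) (uE i)
      & Psi (tpure 1 (uF i)) = tpure (uK (alpha i)) (uF i)].

(* c is the family of components of u for the grading of the first, resp.
   second, tensor leg. *)
Definition leg1_components (u : UqUq) (c : 'rV[int]_r -> UqUq) : Prop :=
  [/\ forall g, tspan (Uq_deg g) [set: Uq] (c g),
      finite_set [set g | c g != 0]
    & u = \sum_(g \in [set: 'rV[int]_r]) c g].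
Definition leg2_components (u : UqUq) (c : 'rV[int]_r -> UqUq) : Prop :=
  [/\ forall g, tspan [set: Uq] (Uq_deg g) (c g),
      finite_set [set g | c g != 0]
    & u = \sum_(g \in [set: 'rV[int]_r]) c g].

(* The family R^+_nu, of which only the values at nu in Q_+ matter. *)
Definition is_Rplus (Delta : Uq -> UqUq) (Psi : UqUq -> UqUq)
    (Rp : 'rV[int]_r -> UqUq) : Prop :=
  let Delta_op := fun x => tflip (Psi (Delta x)) : UqUq in
  [/\ forall nu, Qplus nu ->
        tspan (Uq_nplus `&` Uq_deg nu) (Uq_nminus `&` Uq_deg (- nu)) (Rp nu),
      Rp 0 = 1,
      forall b x c c', Qplus b -> Uq_bplus x ->
        leg1_components (Delta x) c -> leg1_components (Delta_op x) c' ->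
        \sum_(nu \in Qplus_le b) (Rp nu * c (b - nu) - c' (b - nu) * Rp nu) = 0
    & forall b y c c', Qplus b -> Uq_bminus y ->
        leg2_components (Delta y) c -> leg2_components (Delta_op y) c' ->
        \sum_(nu \in Qplus_le b) (Rp nu * c (nu - b) - c' (nu - b) * Rp nu) = 0].

End QuantumGroup.

(* X (x) a, under the identification of 'M[K]_(m, n) (x) A with 'M[A]_(m, n). *)
Definition mxot (K : comNzRingType) (A : lmodType K) (m n : nat)
    (X : 'M[K]_(m, n)) (a : A) : 'M[A]_(m, n) :=
  \matrix_(i, j) (X i j *: a).

Section Module.
Variables (D : cartan_datum) (n : nat).
Local Notation r := (rank D).
Local Notation N := n.+1.
Variable pi : {lrmorphism Uq D -> 'M[Qq]_N}.
Variable lam : 'rV[rat]_r.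

Definition wspace (mu : 'rV[rat]_r) : set 'cV[Qq]_N :=
  [set w | forall b : 'rV[int]_r,
     pi (uK b) *m w = qpow (form mu (rootQ b)) *: w].

(* The set Lambda of weights of V. *)
Definition wt : set 'rV[rat]_r :=
  [set mu | weight_lattice mu /\ exists2 w, w != 0 & wspace mu w].

Definition wt_succ (i : 'I_r) : set 'rV[rat]_r :=
  [set mu | wt mu /\ wt (mu + rootQ (alpha i))].

Definition irreducible_module : Prop :=
  forall W : {vspace 'cV[Qq]_N},
    (forall u w, w \in W -> pi u *m w \in W) -> W = 0%VS \/ W = fullv.

Definition type1_module : Prop :=
  forall w : 'cV[Qq]_N, exists s : seq 'cV[Qq]_N,
    (forall x, x \in s -> exists2 mu, weight_lattice mu & wspace mu x) /\
    w = \sum_(x <- s) x.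

Definition has_highest_weight : Prop :=
  exists v, [/\ v != 0, wspace lam v & forall i, pi (uE i) *m v = 0].

(* The projection onto the weight space of mu along the other ones, that is
   Id_{V_mu} viewed in End(V). *)
Definition wproj (mu : 'rV[rat]_r) : 'M[Qq]_N :=
  xget 0 [set P | forall ga w, wt ga -> wspace ga w ->
    P *m w = if ga == mu then w else 0].

Definition EndV (b : 'rV[int]_r) : set 'M[Qq]_N :=
  [set X | forall mu w, wspace mu w -> wspace (mu + rootQ b) (X *m w)].

Definition EndV_sum (P : set 'rV[int]_r) : set 'M[Qq]_N :=
  [set X | exists s : seq 'M[Qq]_N,
     (forall Y, Y \in s -> exists2 b, P b & EndV b Y) /\ X = \sum_(Y <- s) Y].

Definition basis_of_sum (P : set 'rV[int]_r) (m : nat) (X : m.-tuple 'M[Qq]_N) :=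
  free X /\ forall Y, Y \in <<X>>%VS <-> EndV_sum P Y.

(* The component of T in End(V)_b (x) A: the block projection
   X |-> \sum_mu Id_{V_(mu + b)} X Id_{V_mu} of End(V) tensored with Id_A. *)
Definition mxcomp (A : lmodType Qq) (b : 'rV[int]_r) (T : 'M[A]_N) : 'M[A]_N :=
  \sum_(mu \in wt) \matrix_(i, j) \sum_k \sum_l
    (wproj (mu + rootQ b) i k * wproj mu l j) *: T k l.

(* End(V) (x) End(V) is identified with 'M_(N * N) by the Kronecker product. *)
Definition Dmx : 'M[Qq]_(N * N) :=
  \sum_(mu \in wt) \sum_(ga \in wt)
    qpow (form mu ga - form lam lam) *: (wproj mu *t wproj ga).

Definition Rmx (Rp : 'rV[int]_r -> UqUq D) : 'M[Qq]_(N * N) :=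
  Dmx *m \sum_(nu \in @Qplus D) tlift (fun a b => pi a *t pi b) (Rp nu).

Section UR.
Variables (R : 'M[Qq]_(N * N)) (mp mm : nat).
Variables (Xp : mp.-tuple 'M[Qq]_N) (Xm : mm.-tuple 'M[Qq]_N).

Definition ur_gens : choiceType := ('I_mp + 'I_mm)%type.
Local Notation Fr := (freealg Qq ur_gens).

Definition fLp : 'M[Fr]_N :=
  \sum_k mxot (tnth Xp k) (fgen Qq (inl k : ur_gens)).
Definition fLm : 'M[Fr]_N :=
  \sum_k mxot (tnth Xm k) (fgen Qq (inr k : ur_gens)).

Local Notation R_ := (map_mx (in_alg Fr) R).
Local Notation leg1 T := (T *t (1%:M : 'M[Fr]_N)).
Local Notation leg2 T := ((1%:M : 'M[Fr]_N) *t T).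
Local Notation L0p := (mxcomp 0 fLp).
Local Notation L0m := (mxcomp 0 fLm).

Inductive ur_rel : Fr -> Prop :=
| ur_pm0 i j : ur_rel ((L0p *m L0m - 1%:M) i j)
| ur_mp0 i j : ur_rel ((L0m *m L0p - 1%:M) i j)
| ur_pm i j : ur_rel
    ((R_ *m leg1 fLp *m leg2 fLm - leg2 fLm *m leg1 fLp *m R_) i j)
| ur_pp i j : ur_rel
    ((R_ *m leg1 fLp *m leg2 fLp - leg2 fLp *m leg1 fLp *m R_) i j)
| ur_mm i j : ur_rel
    ((R_ *m leg1 fLm *m leg2 fLm - leg2 fLm *m leg1 fLm *m R_) i j).

Definition UR : Type := qalg ur_rel.
HB.instance Definition _ := GRing.PzRing.on UR.
HB.instance Definition _ := GRing.Lmodule.on UR.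

Definition Lp : 'M[UR]_N :=
  \sum_k mxot (tnth Xp k) (qproj ur_rel (fgen Qq (inl k : ur_gens)) : UR).

Definition is_ell (ell : 'rV[rat]_r -> UR) : Prop :=
  mxcomp 0 Lp = \sum_(mu \in wt) mxot (wproj mu) (ell mu).

End UR.
End Module.

(* Main.v *)
(* Expand the relation R L1 L2 = L2 L1 R (for L = L^+) along the weights of
   V (x) V.  Since L is supported in degrees Q_+ and R^+_nu has bidegree (nu, -nu), only
   R^+_nu contributes to the component of bidegree (nu, -nu), and there L may be replaced
   by its diagonal part.  For nu = 0 the outcome is that the ell_mu commute; for
   nu = alpha_i, where R^+_nu is a nonzero multiple of E_i (x) F_i, it is
     ell_mu ell_(ga + alpha_i) = ell_ga ell_(mu + alpha_i)
   as soon as E_i is nonzero on V_mu and F_i is nonzero on V_(ga + alpha_i).  By a rank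
   one computation this holds for all mu, ga in Lambda_(lam, i), which makes
   ell_(mu + alpha_i)^-1 ell_mu independent of mu.  The product formula follows by
   induction on words in the F_i applied to the highest weight vector, as these span V. *)

Require Import Defs.
From HB Require Import structures.
From mathcomp Require Import all_boot all_order all_algebra.
From mathcomp Require Import ring finmap monalg mxtens.
From mathcomp Require Import boolp classical_sets cardinality fsbigop.

Set Implicit Arguments.
Unset Strict Implicit.
Unset Printing Implicit Defensive.

Import Order.TTheory GRing.Theory Num.Theory.
Local Open Scope classical_set_scope.
Local Open Scope ring_scope.

(** Weight components are extracted by the trace: a matrix A from V_ka to V_mu, paired with L^+,
    sees only its component of degree ka - mu. When the exchange relation is paired with a suitable
    [A *t B], the term R^+_nu meets L^+ in degree nu0 - nu in the first leg and nu - nu0 in the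
    second; both must lie in Q_+, so nu = nu0. The delicate point is that the relation for alpha_i
    says something only if E_i is nonzero on V_mu and F_i on V_(ga + alpha_i), for unrelated mu and
    ga. That mu and mu + alpha_i are weights has to imply both kinds of nonvanishing; this is a
    statement about rank one strings, settled by the sign of mu on the coroot, and it relies on q_i
    not being a root of unity. The scalar in R^+_(alpha_i) is never evaluated: it is nonzero because
    E_i (x) (K_i - K_i^-1) is nonzero on V (x) V. Uniqueness of xi_i rests on Lambda_(lam, i) being
    non-empty, which is derived from lam being nonzero and the Cartan matrix being
    indecomposable. *)

Local Notation form := Defs.form.

(** * Integral powers of q and characters of the weight lattice *)

Lemma q_neq0 : q != 0.
Proof. by rewrite tofrac_eq0 polyX_eq0. Qed.

(** q is an indeterminate, so its nonnegative powers are told apart by polynomial degree; negative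
    exponents reduce to these by inversion. *)
Lemma expq_eq1 (a : int) : q ^ a = 1 -> a = 0.
Proof.
have expn0 (n : nat) : q ^+ n = 1 -> n = 0%N.
  rewrite /q -tofracXn -tofrac1 => /eqP; rewrite tofrac_eq => /eqP.
  move=> /(congr1 (fun p : {poly rat} => size p)) /=.
  by rewrite size_polyXn size_poly1 => -[].
case: a => [n /expn0 -> //|n]; rewrite NegzE -exprnN => /eqP.
by rewrite invr_eq1 => /eqP /expn0.
Qed.

Lemma expq_inj : injective (fun a : int => q ^ a).
Proof.
move=> a b /eqP ab; apply/eqP; rewrite -subr_eq0; apply/eqP/expq_eq1.
by rewrite expfzDr ?q_neq0 // -invr_expz (eqP ab) mulfV // expfz_neq0 // q_neq0.
Qed.

Lemma qpow_neq0 x : qpow x != 0.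
Proof. by rewrite expfz_neq0 // q_neq0. Qed.

Lemma qpow_int (a : int) : qpow a%:~R = q ^ a.
Proof. by rewrite /qpow numq_int. Qed.

(** [qpow] reads off the numerator, so it is multiplicative only on integers; hence the integrality
    conditions carried along below, which [weight_int] discharges. *)
Lemma qpowD x y : x \is a Num.int -> y \is a Num.int -> qpow (x + y) = qpow x * qpow y.
Proof.
move=> /intrP[a ->] /intrP[b ->]; rewrite -rmorphD /= !qpow_int.
by rewrite expfzDr ?q_neq0.
Qed.

Lemma qpow_inj x y : x \is a Num.int -> y \is a Num.int -> qpow x = qpow y -> x = y.
Proof. by move=> /intrP[a ->] /intrP[b ->]; rewrite !qpow_int => /expq_inj ->. Qed.

Section Form.
Variable D : cartan_datum.
Local Notation r := (rank D).
Implicit Types (x y z : 'rV[rat]_r) (b c : 'rV[int]_r).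

Lemma formDl x y z : form (x + y) z = form x z + form y z.
Proof.
rewrite /form /symm_form -big_split; apply: eq_bigr => i _.
rewrite -big_split; apply: eq_bigr => j _.
by rewrite mxE !mulrDl.
Qed.

Lemma formC x y : form x y = form y x.
Proof.
rewrite /form /symm_form exchange_big; apply: eq_bigr => i _.
by apply: eq_bigr => j _; rewrite cartan_symm [x _ _ * _]mulrC.
Qed.

Lemma formZl (k : rat) x y : form (k *: x) y = k * form x y.
Proof.
rewrite /form /symm_form mulr_sumr; apply: eq_bigr => i _.
rewrite mulr_sumr; apply: eq_bigr => j _.
by rewrite mxE !mulrA.
Qed.

Lemma formNl x y : form (- x) y = - form x y.
Proof. by rewrite -scaleN1r formZl mulN1r. Qed.

Lemma formNr x y : form x (- y) = - form x y.
Proof. by rewrite formC formNl formC. Qed.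

Lemma form0l y : form 0 y = 0.
Proof. by rewrite -(scale0r 0) formZl mul0r. Qed.

Lemma rootQD b c : rootQ (b + c) = rootQ b + rootQ c.
Proof. by rewrite /rootQ map_mxD. Qed.

Lemma rootQN b : rootQ (- b) = - rootQ b.
Proof. by rewrite /rootQ map_mxN. Qed.

Lemma rootQB b c : rootQ (b - c) = rootQ b - rootQ c.
Proof. by rewrite rootQD rootQN. Qed.

Lemma rootQ0 : rootQ (0 : 'rV_r) = 0.
Proof. by rewrite /rootQ map_mx0. Qed.

Lemma rootQ_inj : injective (@rootQ D).
Proof.
move=> b c bc; apply/rowP => i; move/rowP/(_ i): bc; rewrite !mxE.
by move/intr_inj.
Qed.

Lemma alpha_neq0 (i : 'I_r) : alpha i != 0.
Proof. by apply/eqP => /rowP/(_ i)/eqP; rewrite !mxE !eqxx. Qed.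

Lemma form_alphaE x (i : 'I_r) :
  form x (rootQ (alpha i)) = \sum_j x 0 j * ((dlen j)%:Z * cartan D j i)%:~R.
Proof.
rewrite /form /symm_form; apply: eq_bigr => j _.
rewrite (bigD1 i) //= big1 ?addr0; first by rewrite !mxE !eqxx mulr1.
by move=> k /negPf ki; rewrite !mxE eqxx ki mulr0 mul0r.
Qed.

Lemma form_alpha (i j : 'I_r) :
  form (rootQ (alpha j)) (rootQ (alpha i)) = ((dlen j)%:Z * cartan D j i)%:~R.
Proof.
rewrite form_alphaE (bigD1 j) //= big1 ?addr0; first by rewrite !mxE !eqxx mul1r.
by move=> k /negPf ki; rewrite !mxE eqxx ki mul0r.
Qed.

Lemma form_rootQ x b : form x (rootQ b) = \sum_i (b 0 i)%:~R * form x (rootQ (alpha i)).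
Proof.
under [RHS]eq_bigr do rewrite form_alphaE mulr_sumr.
rewrite exchange_big; apply: eq_bigr => i _; apply: eq_bigr => j _.
by rewrite mxE mulrCA mulrA.
Qed.

(** The coordinates of x are taken in the simple roots, so the square length of x is the sum of x_j
    (x, alpha_j) and vanishes; positive definiteness concludes. *)
Lemma form_nondeg x : (forall i, form x (rootQ (alpha i)) = 0) -> x = 0.
Proof.
move=> x0; apply/eqP/negPn/negP => /(@cartan_posdef D).
suff -> : symm_form (cartan D) (@dlen D) x x = 0 by rewrite ltxx.
have -> : symm_form (cartan D) (@dlen D) x x =
    \sum_j x 0 j * form x (rootQ (alpha j)).
  under eq_bigr do rewrite form_alphaE mulr_sumr.
  rewrite exchange_big; apply: eq_bigr => i _; apply: eq_bigr => j _.
  by rewrite mulrCA mulrA.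
by rewrite big1 // => j _; rewrite x0 mulr0.
Qed.

Lemma dlen_neq0 (i : 'I_r) : (dlen i)%:R != 0 :> rat.
Proof. by rewrite pnatr_eq0 -lt0n dlen_gt0. Qed.

(** The integer [m] is the value of x on the coroot of alpha_i, that is, the exponent of q_i by
    which K_i acts in weight x. *)
Lemma weight_alpha_int x i : weight_lattice x ->
  exists m : int, form x (rootQ (alpha i)) = (m * (dlen i)%:Z)%:~R.
Proof.
move=> /(_ i) /intrP[m xm]; exists m.
by rewrite -[LHS](divfK (dlen_neq0 i)) xm rmorphM /= pmulrn.
Qed.

Lemma weight_int x b : weight_lattice x -> form x (rootQ b) \is a Num.int.
Proof.
move=> wx; rewrite form_rootQ; apply: rpred_sum => i _.
by have [m ->] := weight_alpha_int i wx; rewrite rpredM ?rpred_int.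
Qed.

Lemma weight_rootQ b : weight_lattice (rootQ b).
Proof.
(* Symmetry comes first so that [form_alpha] produces the factor [dlen i], which cancels the
   denominator. *)
move=> i; rewrite formC form_rootQ mulr_suml; apply: rpred_sum => j _.
rewrite form_alpha rmorphM -mulrA rpredM ?rpred_int //= -pmulrn.
by rewrite mulrAC mulfV ?dlen_neq0 // mul1r rpred_int.
Qed.

Lemma weightD x y : weight_lattice x -> weight_lattice y -> weight_lattice (x + y).
Proof. by move=> wx wy i; rewrite formDl mulrDl rpredD. Qed.

Lemma weightN x : weight_lattice x -> weight_lattice (- x).
Proof. by move=> wx i; rewrite formNl mulNr rpredN. Qed.

Lemma weight_dominant x : dominant x -> weight_lattice x.
Proof. by move=> dx i; apply: intr_nat; apply: dx. Qed.

(* The value at K_b of the character of U_q(h) attached to the weight x. *)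
Definition wchar x b : Qq := qpow (form x (rootQ b)).

Lemma wcharD x y b : weight_lattice x -> weight_lattice y ->
  wchar (x + y) b = wchar x b * wchar y b.
Proof. by move=> wx wy; rewrite /wchar formDl qpowD ?weight_int. Qed.

Lemma wchar_inj x y : weight_lattice x -> weight_lattice y ->
  wchar x =1 wchar y -> x = y.
Proof.
move=> wx wy xy; apply/eqP; rewrite -subr_eq0; apply/eqP/form_nondeg => i.
by rewrite formDl formNl (qpow_inj _ _ (xy (alpha i))) ?weight_int ?subrr.
Qed.

Lemma wchar_sep x y : weight_lattice x -> weight_lattice y -> x != y ->
  exists b, wchar x b != wchar y b.
Proof.
move=> wx wy xy; apply: contrapT => /forallNP no; move/eqP: xy; apply.
by apply: wchar_inj => // b; apply/eqP/negPn/negP/no.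
Qed.

End Form.

(** * Weight spaces *)

Lemma qproj_rel (K : comNzRingType) (A : algType K) (S : set A) x : S x -> qproj S x = 0.
Proof.
move=> Sx; rewrite -[0](rmorph0 (@qproj K A S)); apply/eqP/qalgP; rewrite subr0.
by rewrite -[x]mul1r -[1 * x]mulr1 -[_ * 1]addr0; apply: ideal_genD => //; apply: ideal_gen0.
Qed.

Lemma qproj_eq (K : comNzRingType) (A : algType K) (S : set A) x y :
  S (x - y) -> qproj S x = qproj S y.
Proof. by move=> /qproj_rel/eqP; rewrite qproj_zmod subr_eq0 => /eqP. Qed.

Section UqTheory.
Variable D : cartan_datum.
Local Notation r := (rank D).
Local Notation pr := (@qproj Qq (freealg Qq (uq_gens D)) (@uq_rel D)).

Lemma Uq_projM x y : pr (x * y) = pr x * pr y :> Uq D.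
Proof. exact: (qproj_monoid _).2. Qed.
Lemma Uq_projB x y : pr (x - y) = pr x - pr y :> Uq D.
Proof. exact: qproj_zmod. Qed.
Lemma Uq_projZ k x : pr (k *: x) = k *: pr x :> Uq D.
Proof. exact: qproj_scalable. Qed.

Lemma uK0 : uK 0 = 1 :> Uq D.
Proof. exact: qproj_eq (uq_K0 D). Qed.

Lemma uKD b c : uK (b + c) = uK b * uK c :> Uq D.
Proof. by rewrite -[RHS]Uq_projM; apply/esym/qproj_eq/uq_KK. Qed.

Lemma uKKN b : uK b * uK (- b) = 1 :> Uq D.
Proof. by rewrite -uKD subrr uK0. Qed.

Lemma uKNK b : uK (- b) * uK b = 1 :> Uq D.
Proof. by rewrite -uKD addNr uK0. Qed.

Lemma Uq_deg_uE i : Uq_deg (alpha i) (uE i : Uq D).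
Proof.
move=> b; rewrite formC; have h := qproj_eq (@uq_KE D b i).
rewrite Uq_projM Uq_projM Uq_projZ in h; exact: h.
Qed.

Lemma Uq_deg_uF i : Uq_deg (- alpha i) (uF i : Uq D).
Proof.
move=> b; rewrite formC rootQN formNr; have h := qproj_eq (@uq_KF D b i).
rewrite Uq_projM Uq_projM Uq_projZ in h; exact: h.
Qed.

Lemma uEF_comm i j : uE i * uF j - uF j * uE i
  = ((i == j)%:R / (qi i - (qi i)^-1)) *: (uK (alpha i) - uK (- alpha i)) :> Uq D.
Proof.
have hM := f_equal2 (fun x y : Uq D => x - y) (Uq_projM (fE i) (fF j)) (Uq_projM (fF j) (fE i)).
have hK := f_equal (fun x : Uq D => ((i == j)%:R / (qi i - (qi i)^-1)) *: x)
  (Uq_projB (fK (alpha i)) (fK (- alpha i))).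
apply: etrans (esym hM) _.
apply: etrans (esym (Uq_projB _ _)) _.
apply: etrans (qproj_eq (@uq_EF D i j)) _.
exact: etrans (Uq_projZ _ _) hK.
Qed.

Lemma Uq_deg1 : Uq_deg 0 (1 : Uq D).
Proof. by move=> b; rewrite mulr1 uKKN rootQ0 form0l (qpow_int 0) scale1r. Qed.

Lemma Uq_degM b c (x y : Uq D) : Uq_deg b x -> Uq_deg c y -> Uq_deg (b + c) (x * y).
Proof.
move=> dx dy m; rewrite rootQD formDl qpowD; try exact: weight_int (weight_rootQ _).
move: (dx m) (dy m) => {}dx {}dy.
have -> : uK m * (x * y) * uK (- m) = (uK m * x * uK (- m)) * (uK m * y * uK (- m)).
  by rewrite !mulrA -(mulrA _ _ (uK m)) uKNK mulr1.
by rewrite dx dy -scalerAl -scalerAr scalerA.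
Qed.

Lemma uK_commute b c (x : Uq D) : Uq_deg b x -> uK c * x = wchar (rootQ b) c *: (x * uK c).
Proof. move=> /(_ c) dx; rewrite scalerAl /wchar -dx.
by rewrite -(mulrA _ (uK (- c)) (uK c)) uKNK mulr1. Qed.

End UqTheory.

Section Weights.
Variables (D : cartan_datum) (n : nat).
Local Notation r := (rank D).
Local Notation N := n.+1.
Variable pi : {lrmorphism Uq D -> 'M[Qq]_N}.
Hypothesis pi_type1 : type1_module pi.
Implicit Types (mu ga : 'rV[rat]_r) (b : 'rV[int]_r) (X : 'M[Qq]_N).

Lemma piZ k x : pi (k *: x) = k *: pi x.
Proof. by rewrite linearZ. Qed.

Lemma piB x y : pi (x - y) = pi x - pi y.
Proof. by rewrite rmorphB. Qed.

Lemma piM x y (w : 'cV[Qq]_N) : pi x *m (pi y *m w) = pi (x * y) *m w.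
Proof. by rewrite rmorphM mulmxA. Qed.

(** Weaker than [EndV]: only weights in the weight lattice are tested. Elsewhere [qpow] need not be
    multiplicative, so the action of a homogeneous element is only known to shift genuine
    weights. *)
Definition homog b X := forall mu w, weight_lattice mu -> wspace pi mu w ->
  wspace pi (mu + rootQ b) (X *m w).

Lemma homog_EndV b X : EndV pi b X -> homog b X.
Proof. by move=> h mu w _; apply: h. Qed.

Lemma homog_pi b (x : Uq D) : Uq_deg b x -> homog b (pi x).
Proof.
move=> dx mu w wmu hw c; rewrite piM (uK_commute _ dx) piZ -scalemxAl -piM hw.
rewrite -scalemxAr scalerA -wcharD //.
  by rewrite addrC.
exact: weight_rootQ.
Qed.

(** Type 1 writes each standard basis vector as a sum of weight vectors. Stacking all of these as
    rows gives a matrix of full rank, from which N independent rows are selected. *)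
Lemma weight_basis : exists om : 'I_N -> 'rV[rat]_r, exists2 G : 'M[Qq]_N,
  G \in unitmx & forall k, weight_lattice (om k) /\ wspace pi (om k) (col k G).
Proof.
have /choice[s hs] : forall j : 'I_N, exists s : seq 'cV[Qq]_N,
    (forall x, x \in s -> exists2 mu, weight_lattice mu & wspace pi mu x) /\
    delta_mx j 0 = \sum_(x <- s) x by move=> j; apply: pi_type1.
pose S := flatten [seq s j | j <- enum 'I_N].
pose A : 'M[Qq]_(size S, N) := \matrix_(i < size S) (S`_i)^T.
have Afull : row_full A.
  rewrite -sub1mx; apply/row_subP => j; rewrite row1.
  have -> : delta_mx 0 j = (\sum_(x <- s j) x)^T :> 'rV[Qq]_N.
    by rewrite -(hs j).2 trmx_delta.
  rewrite raddf_sum big_seq; apply: summx_sub => x xs /=.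
  have xS : x \in S by apply/flatten_mapP; exists j => //; rewrite mem_enum.
  have xlt : (index x S < size S)%N by rewrite index_mem.
  apply: (eq_row_sub (Ordinal xlt)).
  by rewrite rowK nth_index.
pose G := (rowsub (fullrankfun Afull) A)^T.
have hG k : exists om, weight_lattice om /\ wspace pi om (col k G).
  have -> : col k G = S`_(fullrankfun Afull k).
    by apply/colP => i; rewrite !mxE.
  have /flatten_mapP[j _ /((hs j).1 _)[om ? ?]] :
    S`_(fullrankfun Afull k) \in S by rewrite mem_nth.
  by exists om.
have /choice[om hom] := hG; exists om; exists G => //.
by rewrite unitmx_tr fullrowsub_unit.
Qed.

Lemma wt_lattice mu : wt pi mu -> weight_lattice mu.
Proof. by case. Qed.

Lemma eq_on_weights m (A B : 'M[Qq]_(m, N)) :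
  (forall mu w, wt pi mu -> wspace pi mu w -> A *m w = B *m w) -> A = B.
Proof.
move=> AB; have [om [G Gu hG]] := weight_basis.
rewrite -[A](mulmxK Gu) -[B](mulmxK Gu); congr (_ *m _).
suff h k : A *m col k G = B *m col k G.
  by apply/matrixP => i k; move/colP/(_ i): (h k); rewrite !colE !mulmxA -!colE !mxE.
have [om_wl wG] := hG k; apply: (AB (om k)) => //; split=> //; exists (col k G) => //.
apply/eqP => G0; have : col k (invmx G *m G) = 0.
  by rewrite colE -mulmxA -colE G0 mulmx0.
rewrite mulVmx // => /colP/(_ k); rewrite !mxE eqxx => /eqP.
by rewrite oner_eq0.
Qed.

(** A K_b separating [om k] from [ga] is diagonal in the basis G; comparing the k-th coordinates of
    K_b w forces that coordinate to vanish. *)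
Lemma weight_coord om G ga w k : G \in unitmx ->
  (forall k, weight_lattice (om k) /\ wspace pi (om k) (col k G)) ->
  weight_lattice ga -> wspace pi ga w -> om k != ga -> (invmx G *m w) k 0 = 0.
Proof.
move=> Gu hG wga hw /wchar_sep[||b]; rewrite ?(hG k).1 //; first exact: (hG k).1.
move=> ne; pose dg : 'M[Qq]_N := diag_mx (\row_j wchar (om j) b).
have piG : pi (uK b) *m G = G *m dg.
  apply/matrixP => i j; have h := (hG j).2 b; rewrite colE mulmxA -!colE in h.
  have {}h : (pi (uK b) *m G) i j = wchar (om j) b * G i j.
    by move/colP/(_ i): h; rewrite mxE => ->; rewrite !mxE.
  by rewrite h mul_mx_diag !mxE mulrC.
have [c wE ->] : exists2 c, w = G *m c & invmx G *m w = c.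
  by exists (invmx G *m w) => //; rewrite mulKVmx.
have hK : dg *m c = wchar ga b *: c.
  by rewrite -(mulKmx Gu (dg *m c)) (mulmxA G) -piG -mulmxA -wE hw -scalemxAr wE mulKmx.
move/colP/(_ k): hK.
rewrite mul_diag_mx !mxE => /eqP; rewrite -subr_eq0 -mulrBl mulf_eq0 subr_eq0.
by rewrite (negPf ne) /= => /eqP.
Qed.

(** Every weight is one of the [om k] of a weight basis, since otherwise all coordinates of its
    weight vectors vanish. *)
Lemma finite_wt : finite_set (wt pi).
Proof.
have [om [G Gu hG]] := weight_basis.
apply: (@sub_finite_set _ _ [set` [seq om k | k <- enum 'I_N]]); last exact: finite_seq.
move=> mu [wmu [w w0 hw]] /=; apply: contraT => no.
case/eqP: w0; rewrite -[w](mulKVmx Gu) [X in G *m X](_ : _ = 0) ?mulmx0 //.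
apply/colP => k; rewrite [RHS]mxE; apply: (weight_coord Gu hG wmu hw).
by apply: contraNneq no => <-; apply: map_f; rewrite mem_enum.
Qed.

(** [wproj] is obtained by choice, so a matrix with the required property has to be exhibited: the
    diagonal idempotent selecting the [k] with [om k = mu], conjugated by the weight basis. *)
Lemma wprojE mu ga w : weight_lattice ga -> wspace pi ga w ->
  wproj pi mu *m w = if ga == mu then w else 0.
Proof.
(* A zero vector does not show that [ga] is a weight, but then both sides are zero. *)
move=> wga hw; have [-> | w0] := eqVneq w 0; first by rewrite mulmx0 if_same.
suff h : [set P | forall ga w, wt pi ga -> wspace pi ga w ->
    P *m w = if ga == mu then w else 0] (wproj pi mu).
  by apply: h => //; split=> //; exists w.
apply: (@xgetPex _ 0 [set P | forall ga w, wt pi ga -> wspace pi ga w ->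
    P *m w = if ga == mu then w else 0]).
have [om [G Gu hG]] := weight_basis.
exists (G *m diag_mx (\row_j (om j == mu)%:R) *m invmx G) => {hw w0 wga}ga {}w wga hw.
rewrite -mulmxA -{2}[w](mulKVmx Gu) -mulmxA.
have coord := weight_coord Gu hG (wt_lattice wga) hw.
set c := invmx G *m w in coord *; move: c coord => c coord.
have -> : diag_mx (\row_j (om j == mu)%:R) *m c = (ga == mu)%:R *: c.
  apply/colP => k; rewrite mul_diag_mx !mxE.
  have [->//|/coord ->] := eqVneq (om k) ga; by rewrite !mulr0.
by rewrite -scalemxAr; case: eqP; rewrite ?scale1r ?scale0r.
Qed.

Lemma wproj_id mu w : weight_lattice mu -> wspace pi mu w -> wproj pi mu *m w = w.
Proof. by move=> wmu hw; rewrite (wprojE mu wmu hw) eqxx. Qed.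

Lemma wproj_wspace mu w : wspace pi mu (wproj pi mu *m w).
Proof.
move=> b; rewrite mulmxA scalemxAl; congr (_ *m w).
apply: eq_on_weights => ga {}w [wga _] hw.
rewrite -mulmxA -scalemxAl (wprojE mu wga hw).
by case: eqP => [<-|_]; [apply: hw | rewrite mulmx0 scaler0].
Qed.

Lemma wprojM mu ga : weight_lattice ga ->
  wproj pi mu *m wproj pi ga = if ga == mu then wproj pi ga else 0.
Proof.
move=> wga; apply/matrixP => i j.
have := wprojE mu wga (@wproj_wspace ga (delta_mx j 0)).
rewrite mulmxA -colE => /colP/(_ i); rewrite mxE => ->.
by case: eqP; rewrite -?colE !mxE.
Qed.

Lemma wproj_idem mu : weight_lattice mu -> wproj pi mu *m wproj pi mu = wproj pi mu.
Proof. by move=> wmu; rewrite wprojM // eqxx. Qed.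

Lemma wproj_homog b mu X : homog b X -> weight_lattice mu ->
  X *m wproj pi mu = wproj pi (mu + rootQ b) *m X.
Proof.
move=> hX wmu; apply: eq_on_weights => ga w [wga _] hw; rewrite -!mulmxA.
have hXw := hX _ _ wga hw.
rewrite (wprojE _ wga hw) (wprojE _ _ hXw); last exact: weightD (weight_rootQ _).
by rewrite (inj_eq (addIr _)); case: ifP; rewrite ?mulmx0.
Qed.

Lemma wproj_neq0 mu : wt pi mu -> wproj pi mu != 0.
Proof.
case=> wmu [w w0 hw]; apply: contraNneq w0 => P0.
by rewrite -(wproj_id wmu hw) P0 mul0mx.
Qed.

Lemma neq0_wt mu w : weight_lattice mu -> wspace pi mu w -> w != 0 -> wt pi mu.
Proof. by move=> wmu hw w0; split=> //; exists w. Qed.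

Lemma wproj_not_wt mu : weight_lattice mu -> ~ wt pi mu -> wproj pi mu = 0.
Proof.
move=> wmu nwt; apply/matrixP => i j; rewrite [RHS]mxE.
have [w0|w0] := eqVneq (wproj pi mu *m (delta_mx j 0 : 'cV_N)) 0; last first.
  by case: nwt; apply: neq0_wt w0 => //; apply: wproj_wspace.
by move/colP/(_ i): w0; rewrite -colE !mxE.
Qed.

Lemma wt_sumE (A : zmodType) (F : 'rV[rat]_r -> A) :
  \sum_(mu \in wt pi) F mu = \sum_(mu <- fset_set (wt pi)) F mu.
Proof. exact/fsbig_finite/finite_wt. Qed.

Lemma mem_wts mu : (mu \in fset_set (wt pi)) = `[< wt pi mu >].
Proof.
rewrite in_fset_set; last exact: finite_wt.
by apply/idP/asboolP => [/set_mem|/mem_set].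
Qed.

Lemma wt_sum_delta (A : zmodType) (F : 'rV[rat]_r -> A) mu : wt pi mu ->
  (forall ga, wt pi ga -> ga != mu -> F ga = 0) -> \sum_(ga \in wt pi) F ga = F mu.
Proof.
move=> wmu F0; rewrite wt_sumE (bigD1_seq mu) ?mem_wts ?fset_uniq //=; last exact/asboolP.
by rewrite big_seq_cond big1 ?addr0 // => ga /andP[]; rewrite mem_wts => /asboolP; apply: F0.
Qed.

End Weights.

(** * Strings of a single simple root *)

Lemma qi_neq0 (D : cartan_datum) (i : 'I_(rank D)) : qi i != 0.
Proof. by rewrite expf_neq0 // q_neq0. Qed.

Lemma expqi_eq1 (D : cartan_datum) (i : 'I_(rank D)) (k : int) : qi i ^ k = 1 -> k = 0.
Proof.
rewrite /qi exprnP exprz_exp => /expq_eq1/eqP; rewrite mulf_eq0 => /orP[|/eqP//].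
by rewrite eqz_nat -leqn0 leqNgt dlen_gt0.
Qed.

Lemma expqi_diff_neq0 (D : cartan_datum) (i : 'I_(rank D)) (k : int) :
  k != 0 -> qi i ^ k - qi i ^ (- k) != 0.
Proof.
apply: contraNneq => /eqP; rewrite subr_eq0 => /eqP e.
have : qi i ^ (k + k) = 1.
  by rewrite expfzDr ?qi_neq0 // {1}e -expfzDr ?qi_neq0 // addNr.
by move/expqi_eq1/eqP; rewrite -mulr2n mulrn_eq0.
Qed.

Lemma qi_diff_neq0 (D : cartan_datum) (i : 'I_(rank D)) : qi i - (qi i)^-1 != 0.
Proof. by have := @expqi_diff_neq0 D i 1 isT; rewrite expr1z -invr_expz expr1z. Qed.

(* The sum of the weights along a string is [j]_v [m + j - 1]_v. *)
Lemma sum_qint_string (K : fieldType) (v : K) (m j : nat) : v != 0 -> (0 < m)%N ->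
  (v - v^-1) * \sum_(t < j) (v ^+ (m + t.*2) - v ^- (m + t.*2))
  = (v ^+ j - v ^- j) * (v ^+ (m + j).-1 - v ^- (m + j).-1).
Proof.
case: m => // m v0 _; elim: j => [|j IH].
  by rewrite big_ord0 mulr0 !expr0 invr1 subrr mul0r.
rewrite big_ord_recr /= mulrDr IH !(addSn, addnS) /= -addnn !(exprS, exprD).
have /expf_neq0 vj := v0; have /(_ j) vj0 := vj; have /(_ m) vm0 := vj.
set a := v ^+ j in vj0 *; set b := v ^+ m in vm0 *.
by field; rewrite v0 vj0 vm0.
Qed.

(* If A B w = 0 then B A^(j+1) w is a nonzero multiple of A^j w. *)
Lemma sl2_string (K : fieldType) (N : nat) (A B : 'M[K]_N) (w : 'cV[K]_N) (v c : K) (m : nat) :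
  (0 < m)%N -> v != 0 -> c != 0 -> (forall k : nat, (0 < k)%N -> v ^+ k != v ^- k) ->
  (forall j, B *m (A *m iter j (mulmx A) w) = A *m (B *m iter j (mulmx A) w)
     - (c * (v ^+ (m + j.*2) - v ^- (m + j.*2))) *: iter j (mulmx A) w) ->
  w != 0 -> A *m (B *m w) = 0 -> forall j, iter j (mulmx A) w != 0.
Proof.
move=> m0 v0 c0 vk rel w0 ABw.
(* [- S j.+1] is the scalar in [BA] below: moving B past each factor A contributes one summand, and
   the boundary term A B w is zero. *)
pose S j := c * \sum_(t < j) (v ^+ (m + t.*2) - v ^- (m + t.*2)).
have S0 j : (0 < j)%N -> S j != 0.
  move=> j0; rewrite mulf_neq0 //.
  apply/eqP => s0; have /eqP := sum_qint_string j v0 m0.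
  rewrite s0 mulr0 eq_sym mulf_eq0 !subr_eq0 (negPf (vk _ j0)) (negPf (vk _ _)) //.
  (* The second factor of the closed form has exponent [(m + j).-1], which is positive because m and
     j both are. *)
  by case: (m) m0 => // m' _; rewrite addSn addn_gt0 j0 orbT.
have BA j : B *m iter j.+1 (mulmx A) w = - S j.+1 *: iter j (mulmx A) w.
  elim: j => [|j IH]; rewrite iterS rel.
    by rewrite ABw sub0r scaleNr /S big_ord1.
  rewrite IH -scalemxAr -[A *m iter j _ w]/(iter j.+1 (mulmx A) w) -scaleNr -scalerDl.
  congr (_ *: _); rewrite -opprD -mulrDr; congr (- (c * _)).
  by rewrite [in RHS]big_ord_recr.
elim=> [//|j IH]; apply/eqP => Aj; have := BA j; rewrite Aj mulmx0 => /esym/eqP.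
by rewrite scaler_eq0 oppr_eq0 (negPf (S0 _ _)) // (negPf IH).
Qed.

Section Sl2.
Variables (D : cartan_datum) (n : nat).
Local Notation r := (rank D).
Local Notation N := n.+1.
Variable pi : {lrmorphism Uq D -> 'M[Qq]_N}.
Hypothesis pi_type1 : type1_module pi.
Implicit Types (mu ga : 'rV[rat]_r) (b : 'rV[int]_r) (X : 'M[Qq]_N).

Lemma homog_iter b X mu w j : homog pi b X -> weight_lattice mu -> wspace pi mu w ->
  wspace pi (mu + rootQ (b *+ j)) (iter j (mulmx X) w).
Proof.
move=> hX wmu hw; elim: j => [|j IH]; first by rewrite mulr0n rootQ0 addr0.
rewrite mulrSr rootQD addrA; apply: hX => //.
exact: weightD (weight_rootQ _).
Qed.

(** If no iterate vanished, the pairwise distinct elements mu + j b would all be weights,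
    contradicting finiteness. *)
Lemma homog_nilp b X mu w : b != 0 -> homog pi b X -> weight_lattice mu -> wspace pi mu w ->
  exists j, iter j (mulmx X) w = 0.
Proof.
move=> b0 hX wmu hw; apply: contrapT => /forallNP no.
pose f j := mu + rootQ (b *+ j).
have [i bi] : exists i, b 0 i != 0.
  apply: contrapT => /forallNP bz; case/eqP: b0; apply/rowP => i.
  by rewrite mxE; apply/eqP/negPn/negP/bz.
have finj : injective f.
  move=> j k /addrI/rootQ_inj/rowP/(_ i); rewrite !mulmxnE.
  exact: mulrIn.
have fwt j : f j \in fset_set (wt pi).
  rewrite mem_wts //; apply/asboolP; apply: (@neq0_wt _ _ _ _ (iter j (mulmx X) w)).
  - exact: weightD (weight_rootQ _).
  - exact: homog_iter.
  - exact/eqP/no.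
pose W : seq _ := fset_set (wt pi).
have := @uniq_leq_size _ [seq f j | j <- iota 0 (size W).+1] W.
rewrite map_inj_uniq ?iota_uniq // size_map size_iota ltnn => /(_ isT) h.
by apply/notF/h => _ /mapP[j _ ->]; apply: fwt.
Qed.

Lemma form_alpha_diag (i : 'I_r) :
  form (rootQ (alpha i)) (rootQ (alpha i)) = (2 * (dlen i)%:Z)%:~R.
Proof. by rewrite form_alpha cartan_diag mulrC. Qed.

Lemma wchar_alpha mu i (m : int) : form mu (rootQ (alpha i)) = (m * (dlen i)%:Z)%:~R ->
  wchar mu (alpha i) = qi i ^ m /\ wchar mu (- alpha i) = qi i ^ (- m).
Proof.
move=> fm; rewrite /wchar rootQN formNr fm -rmorphN /= !qpow_int /qi !exprnP !exprz_exp.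
by rewrite mulrN mulrC.
Qed.

(** The scalar is the quantum integer [m] in q_i, with m the value of mu on the coroot. *)
Lemma EF_comm_weight mu i (m : int) w : wspace pi mu w ->
  form mu (rootQ (alpha i)) = (m * (dlen i)%:Z)%:~R ->
  pi (uE i) *m (pi (uF i) *m w) - pi (uF i) *m (pi (uE i) *m w) =
  ((qi i - (qi i)^-1)^-1 * (qi i ^ m - qi i ^ (- m))) *: w.
Proof.
move=> hw fm; rewrite !piM -mulmxBl -piB (uEF_comm i i) eqxx div1r piZ piB.
rewrite -scalemxAl mulmxBl !hw -scalerBl scalerA.
by have [] := wchar_alpha fm; rewrite /wchar => -> ->.
Qed.

Lemma form_shift mu i j (m : int) : form mu (rootQ (alpha i)) = (m * (dlen i)%:Z)%:~R ->
  form (mu + rootQ (alpha i *+ j)) (rootQ (alpha i)) = ((m + j.*2%:Z) * (dlen i)%:Z)%:~R /\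
  form (mu + rootQ ((- alpha i) *+ j)) (rootQ (alpha i)) = ((m - j.*2%:Z) * (dlen i)%:Z)%:~R.
Proof.
have fj k : form (rootQ (alpha i *+ k)) (rootQ (alpha i)) = (k.*2%:Z * (dlen i)%:Z)%:~R.
  elim: k => [|k IH]; first by rewrite mulr0n rootQ0 form0l.
  rewrite mulrSr rootQD formDl IH form_alpha_diag -rmorphD /= -mulrDl.
  by rewrite doubleS -(addn2 k.*2) PoszD.
move=> fm; rewrite !formDl mulNrn rootQN formNl fm fj -rmorphD -rmorphB /=.
by rewrite mulrDl mulrBl.
Qed.

Lemma expqi_natdiff (i : 'I_r) (k : nat) : (0 < k)%N -> qi i ^+ k != qi i ^- k.
Proof.
move=> k0; rewrite -subr_eq0; have := @expqi_diff_neq0 D i k.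
by rewrite -invr_expz eqz_nat -lt0n; apply.
Qed.

(** If E_i F_i w were zero, raising w would run through the coroot values m, m + 2, ..., all
    positive; by [sl2_string] no power of E_i would kill w, against nilpotency. *)
Lemma weight_pos_EF mu i (m : nat) w : weight_lattice mu -> wspace pi mu w -> w != 0 ->
  form mu (rootQ (alpha i)) = (m%:Z * (dlen i)%:Z)%:~R -> (0 < m)%N ->
  pi (uE i) *m (pi (uF i) *m w) != 0.
Proof.
move=> wmu hw w0 fm m0; apply/eqP => EF0.
have hE := homog_pi (pi := pi) (Uq_deg_uE i).
have [j /eqP] := homog_nilp (alpha_neq0 i) hE wmu hw; apply/negP.
apply: (@sl2_string _ _ (pi (uE i)) (pi (uF i)) w (qi i) (qi i - (qi i)^-1)^-1 m) => //.
- exact: qi_neq0.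
- by rewrite invr_neq0 // qi_diff_neq0.
- exact: expqi_natdiff.
move=> k; have hk := homog_iter k hE wmu hw.
have := EF_comm_weight hk (form_shift k fm).1.
by rewrite -PoszD -invr_expz => <-; rewrite opprB addrC subrK.
Qed.

(** The mirror argument: lowering runs through -m, -m - 2, ..., and no power of F_i would kill w. *)
Lemma weight_neg_FE mu i (m : nat) w : weight_lattice mu -> wspace pi mu w -> w != 0 ->
  form mu (rootQ (alpha i)) = (- m%:Z * (dlen i)%:Z)%:~R -> (0 < m)%N ->
  pi (uF i) *m (pi (uE i) *m w) != 0.
Proof.
move=> wmu hw w0 fm m0; apply/eqP => FE0.
have hF := homog_pi (pi := pi) (Uq_deg_uF i).
have a0 : - alpha i != 0 by rewrite oppr_eq0 alpha_neq0.
have [j /eqP] := homog_nilp a0 hF wmu hw; apply/negP.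
apply: (@sl2_string _ _ (pi (uF i)) (pi (uE i)) w (qi i) (qi i - (qi i)^-1)^-1 m) => //.
- exact: qi_neq0.
- by rewrite invr_neq0 // qi_diff_neq0.
- exact: expqi_natdiff.
move=> k; have hk := homog_iter k hF wmu hw.
have := EF_comm_weight hk (form_shift k fm).2.
(* Exchanging the roles of E_i and F_i reverses the commutator, and the negative weights reverse the
   quantum integer; together they give the shape that [sl2_string] expects. *)
have -> : qi i ^ (- m%:Z - k.*2%:Z) - qi i ^ (- (- m%:Z - k.*2%:Z)) =
    - (qi i ^+ (m + k.*2) - qi i ^- (m + k.*2)).
  by rewrite -opprD -PoszD opprK -invr_expz opprB.
rewrite mulrN scaleNr => /eqP.
by rewrite subr_eq addrC => /eqP.
Qed.

(** One vector witnesses both claims. If m >= 0, the coroot value at mu + alpha_i is m + 2 > 0, so w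
    there has E_i F_i w nonzero: F_i is nonzero on w and E_i on F_i w. If m < 0, the same works from
    w in V_mu with F_i E_i w nonzero. *)
Lemma wt_succ_EF i mu : wt_succ pi i mu ->
  wproj pi (mu + rootQ (alpha i)) *m pi (uE i) *m wproj pi mu != 0 /\
  wproj pi mu *m pi (uF i) *m wproj pi (mu + rootQ (alpha i)) != 0.
Proof.
move=> [wtmu wtmua].
have nzE (w : 'cV[Qq]_N) : wspace pi mu w -> pi (uE i) *m w != 0 ->
    wproj pi (mu + rootQ (alpha i)) *m pi (uE i) *m wproj pi mu != 0.
  move=> hw; apply: contraNneq => P0.
  have hEw := homog_pi (pi := pi) (Uq_deg_uE i) (wt_lattice wtmu) hw.
  rewrite -(wproj_id pi_type1 (wt_lattice wtmua) hEw).
  by rewrite -{1}(wproj_id pi_type1 (wt_lattice wtmu) hw) !mulmxA P0 mul0mx.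
have nzF (w : 'cV[Qq]_N) : wspace pi (mu + rootQ (alpha i)) w -> pi (uF i) *m w != 0 ->
    wproj pi mu *m pi (uF i) *m wproj pi (mu + rootQ (alpha i)) != 0.
  move=> hw; apply: contraNneq => P0.
  have := homog_pi (pi := pi) (Uq_deg_uF i) (wt_lattice wtmua) hw.
  rewrite rootQN addrK => hFw.
  rewrite -(wproj_id pi_type1 (wt_lattice wtmu) hFw).
  by rewrite -{1}(wproj_id pi_type1 (wt_lattice wtmua) hw) !mulmxA P0 mul0mx.
have [m fm] := weight_alpha_int i (wt_lattice wtmu).
have [m0|m0] := lerP 0 m.
  have [wmua [w w0 hw]] := wtmua.
  have fma : form (mu + rootQ (alpha i)) (rootQ (alpha i)) =
      ((`|m| + 2)%N%:Z * (dlen i)%:Z)%:~R.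
    by have := (form_shift 1 fm).1; rewrite mulr1n => ->; rewrite PoszD gez0_abs.
  have EF := weight_pos_EF wmua hw w0 fma; rewrite addn2 in EF; have {}EF := EF isT.
  have hFw := homog_pi (pi := pi) (Uq_deg_uF i) wmua hw; rewrite rootQN addrK in hFw.
  split; first exact: nzE EF.
  by apply: nzF hw _; apply: contraNneq EF => ->; rewrite mulmx0.
have [wmu [w w0 hw]] := wtmu.
have FE : pi (uF i) *m (pi (uE i) *m w) != 0.
  apply: (@weight_neg_FE mu i `|m|%N) => //; last by rewrite absz_gt0 lt_eqF.
  by rewrite fm ltz0_abs // opprK.
have hEw := homog_pi (pi := pi) (Uq_deg_uE i) wmu hw.
split; last exact: nzF FE.
by apply: nzE hw _; apply: contraNneq FE => ->; rewrite mulmx0.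
Qed.

End Sl2.

(** * The highest weight vector *)

(** A representative in the free algebra is a finite linear combination of words, and words are
    treated by induction on their length. *)
Lemma Uq_ind (D : cartan_datum) (P : Uq D -> Prop) : P 1 ->
  (forall x y, P x -> P y -> P (x + y)) -> (forall k x, P x -> P (k *: x)) ->
  (forall x y, P x -> P y -> P (x * y)) ->
  (forall i, P (uE i)) -> (forall i, P (uF i)) -> (forall b, P (uK b)) -> forall x, P x.
Proof.
move=> P1 PD PZ PM PE PF PK; elim/quotW=> x; rewrite -/(qproj (@uq_rel D) x).
have P0 : P 0 by rewrite -(scale0r 1); apply: PZ.
rewrite (monalgE x).
have sumE (s : seq {fmonom uq_gens D}) (F : {fmonom uq_gens D} -> freealg Qq (uq_gens D)) :
    qproj (@uq_rel D) (\sum_(k <- s) F k) = \sum_(k <- s) qproj (@uq_rel D) (F k).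
  elim: s => [|k s IH]; first by rewrite !big_nil.
  by rewrite !big_cons -IH; exact: (raddfD (@qproj _ _ (@uq_rel D))).
rewrite sumE; apply: (big_ind P) => // k _.
pose mon (m : {fmonom uq_gens D}) : freealg Qq (uq_gens D) := mkmalgU m 1.
have -> : << x@_k *g k >> = x@_k *: mon k :> freealg Qq (uq_gens D).
  by apply/malgP => m; rewrite mcoeffZ !mcoeffU mulrnAr mulr1.
rewrite qproj_scalable; apply: PZ => {x}.
have monM m1 m2 : mon (mmul m1 m2) = mon m1 * mon m2.
  by rewrite /mon [RHS]malgM_def fgmulUU mulr1.
case: k => s; elim: s => [|g s IH].
  have -> : FMonom [::] = mone :> {fmonom uq_gens D} by apply/val_inj; rewrite /= fm1.
  have -> : mon mone = 1 
    by apply/malgP => m; rewrite mcoeffU1 eq_sym -(mcoeff1 Qq m).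
  by rewrite (qproj_monoid _).1.
have -> : FMonom (g :: s) = mmul (fmu g) (FMonom s).
  by apply/val_inj/esym; apply: etrans (fmM _ _) _; rewrite fmU.
rewrite monM (qproj_monoid _).2; apply: PM => //.
by case: g => [[i|i]|b]; [apply: PE|apply: PF|apply: PK].
Qed.

Section HighestWeight.
Variables (D : cartan_datum) (n : nat).
Local Notation r := (rank D).
Local Notation N := n.+1.
Variables (pi : {lrmorphism Uq D -> 'M[Qq]_N}) (lam : 'rV[rat]_r).
Hypothesis pi_type1 : type1_module pi.
Hypothesis lam_dom : dominant lam.
Implicit Types (mu ga : 'rV[rat]_r) (b : 'rV[int]_r) (X : 'M[Qq]_N).

Lemma wt_highest : has_highest_weight pi lam -> wt pi lam.
Proof. by case=> v [v0 hv _]; split; [exact: weight_dominant | exists v]. Qed.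

(** Without a pair of weights differing by alpha_i, both E_i and F_i kill every weight vector; so
    does their commutator, which acts by [m] in q_i, and hence m = 0. *)
Lemma no_wt_succ_orth i : (forall mu, ~ wt_succ pi i mu) ->
  forall mu, wt pi mu -> form mu (rootQ (alpha i)) = 0.
Proof.
move=> no mu wtmu; have [wmu [w w0 hw]] := wtmu.
have [m fm] := weight_alpha_int i wmu.
have E0 : pi (uE i) *m w = 0.
  apply/eqP/negPn/negP => Ew; case: (no mu); split=> //.
  apply: neq0_wt (homog_pi (pi := pi) (Uq_deg_uE i) wmu hw) Ew.
  exact: weightD (weight_rootQ _).
have F0 : pi (uF i) *m w = 0.
  apply/eqP/negPn/negP => Fw; case: (no (mu - rootQ (alpha i))).
  have wl : weight_lattice (mu - rootQ (alpha i)).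
    by apply: weightD => //; exact/weightN/weight_rootQ.
  split; last by rewrite subrK.
  have := homog_pi (pi := pi) (Uq_deg_uF i) wmu hw; rewrite rootQN => hFw.
  exact: neq0_wt wl hFw Fw.
have /eqP := EF_comm_weight hw fm; rewrite E0 F0 !mulmx0 subrr eq_sym scaler_eq0.
rewrite (negPf w0) orbF mulf_eq0 invr_eq0 (negPf (qi_diff_neq0 i)) /=.
rewrite fm; case: (eqVneq m 0) => [->|/(expqi_diff_neq0 i)/negPf->//].
by rewrite mul0r.
Qed.

(** Let J collect the indices with empty Lambda_(lam, j). If J is everything, lam is orthogonal to
    all simple roots, so it is zero. Otherwise indecomposability gives k in J linked to some j
    outside J; mu and mu + alpha_j are then both orthogonal to alpha_k, hence so is alpha_j, a
    contradiction. *)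
Lemma wt_succ_nonempty : lam != 0 -> has_highest_weight pi lam ->
  forall i, exists mu, wt_succ pi i mu.
Proof.
move=> lam0 /wt_highest wtlam i.
pose J := [set i : 'I_r | `[< forall mu, ~ wt_succ pi i mu >]]%SET.
have inJ j : j \in J -> forall mu, ~ wt_succ pi j mu by rewrite inE => /asboolP.
have ninJ j : j \notin J -> exists mu, wt_succ pi j mu.
  by rewrite inE => /asboolPn/existsNP[mu /contrapT]; exists mu.
apply: contrapT => /forallNP no.
have Ji : i \in J by rewrite inE; apply/asboolP.
have J0 : J != finset.set0 by apply/eqP => J0; rewrite J0 inE in Ji.
have [JT|JT] := eqVneq J finset.setT.
  case/eqP: lam0; apply: form_nondeg => j.
  by apply: no_wt_succ_orth => //; apply: inJ; rewrite JT inE.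
have [k [j [/inJ kJ /ninJ[mu [wtmu wtmuj]] akj]]] := cartan_indec J0 JT.
have := no_wt_succ_orth kJ wtmuj; rewrite formDl (no_wt_succ_orth kJ wtmu) add0r.
rewrite form_alpha -cartan_symm => /eqP; rewrite intr_eq0 mulf_eq0 (negPf akj) orbF.
by rewrite eqz_nat -leqn0 leqNgt dlen_gt0.
Qed.

Section Words.
Variable v : 'cV[Qq]_N.
Hypotheses (v0 : v != 0) (hv : wspace pi lam v).
Hypothesis Ev : forall i, pi (uE i) *m v = 0.
Hypothesis pi_irr : irreducible_module pi.

Definition word (s : seq 'I_r) : 'cV[Qq]_N := foldr (fun i w => pi (uF i) *m w) v s.

Definition word_weight (s : seq 'I_r) : 'rV[rat]_r := lam - rootQ (\sum_(i <- s) alpha i).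

Lemma weight_lattice_word s : weight_lattice (word_weight s).
Proof. by apply: weightD (weight_dominant lam_dom) _; apply/weightN/weight_rootQ. Qed.

Lemma word_weight_cons i s : word_weight (i :: s) = word_weight s + rootQ (- alpha i).
Proof. by rewrite /word_weight big_cons rootQD rootQN opprD addrA addrAC. Qed.

Lemma word_wspace s : wspace pi (word_weight s) (word s).
Proof.
elim: s => [|i s IH]; first by rewrite /word_weight big_nil rootQ0 subr0.
rewrite word_weight_cons; apply: homog_pi IH; first exact: Uq_deg_uF.
exact: weight_lattice_word.
Qed.

(** A finite list of words whose span has maximal dimension cannot be enlarged by a further word. *)
Lemma words_span : exists ss : seq (seq 'I_r), forall s, word s \in <<map word ss>>%VS.
Proof.
pose P d := `[< exists ss : seq (seq 'I_r), \dim <<map word ss>>%VS = d >].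
have exP : exists d, P d by exists (\dim <<map word [::]>>%VS); apply/asboolP; exists [::].
have bound d : P d -> (d <= \dim (fullv : {vspace 'cV[Qq]_N}))%N.
  by move=> /asboolP[ss <-]; apply/dimvS/subvf.
have [d /asboolP[ss dss] dmax] := ex_maxnP exP bound.
exists ss => s; have sub : (<<map word ss>> <= <<map word (s :: ss)>>)%VS.
  by rewrite /= span_cons addvSr.
have le : (\dim <<map word (s :: ss)>> <= \dim <<map word ss>>)%N.
  by rewrite dss; apply: dmax; apply/asboolP; exists (s :: ss).
have : (<<map word (s :: ss)>> <= <<map word ss>>)%VS.
  by rewrite -(dimv_leqif_sup sub) eqn_leq le dimvS.
move/subvP; apply.
by rewrite memv_span // mem_head.
Qed.

(** The span W of all words is a nonzero submodule: F_i prolongs words, K_b scales them, and E_i is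
    moved inward to the highest weight vector. Irreducibility makes W everything. *)
Lemma span_words : exists ss : seq (seq 'I_r), <<map word ss>>%VS = fullv.
Proof.
have [ss hss] := words_span; exists ss; set W := <<_>>%VS in hss *.
pose stab x := forall w, w \in W -> pi x *m w \in W.
have stabP x : (forall s, pi x *m word s \in W) -> stab x.
  move=> hx w wW; have : (W <= linfun (mulmx (pi x)) @^-1: W)%VS.
    apply/span_subvP => _ /mapP[s _ ->]; rewrite -memv_preim lfunE; exact: hx.
  by move/subvP/(_ w wW); rewrite -memv_preim lfunE.
have stabF i : stab (uF i) by apply: stabP => s; apply: (hss (i :: s)).
have stabK b : stab (uK b).
  by apply: stabP => s; rewrite word_wspace memvZ.
have stabE i : stab (uE i).
  apply: stabP => s; elim: s => [|j s IH]; first by rewrite /= Ev mem0v.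
  (* E_i F_j w is split as the commutator applied to w, a combination of K's, plus F_j E_i w, which
     is covered by the induction hypothesis. *)
  rewrite /= -[X in X \in _](subrK (pi (uF j) *m (pi (uE i) *m word s))).
  apply: memvD; last exact: stabF.
  rewrite !piM -mulmxBl -piB uEF_comm piZ piB -scalemxAl mulmxBl.
  by apply/memvZ/memvB; apply: stabK.
have [|W0|//] := pi_irr (W := W); last first.
  by have := hss [::]; rewrite W0 memv0 (negPf v0).
apply: Uq_ind; last exact: stabK; last exact: stabF; last exact: stabE.
- by move=> w; rewrite rmorph1 mul1mx.
- by move=> x y hx hy w wW; rewrite raddfD mulmxDl; apply: memvD; [apply: hx|apply: hy].
- by move=> k x hx w wW; rewrite piZ -scalemxAl; apply/memvZ/hx.
- by move=> x y hx hy w wW; rewrite -piM; apply/hx/hy.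
Qed.

(** The projection onto V_mu kills every word of another weight; if no nonzero word had weight mu it
    would vanish on a spanning set. *)
Lemma wt_word mu : wt pi mu -> exists2 s, mu = word_weight s & word s != 0.
Proof.
move=> wtmu; have [ss hss] := span_words; apply: contrapT => no.
case/eqP: (wproj_neq0 pi_type1 wtmu).
have kill s : wproj pi mu *m word s = 0.
  rewrite (wprojE pi_type1 _ (weight_lattice_word s) (word_wspace s)).
  case: eqP => // e; have [//|s0] := eqVneq (word s) 0.
  by case: no; exists s.
have : (<<map word ss>> <= lker (linfun (mulmx (wproj pi mu))))%VS.
  apply/span_subvP => _ /mapP[s _ ->].
  by rewrite memv_ker lfunE /= kill.
move=> /subvP h; apply/matrixP => i j.
have /h : (delta_mx j 0 : 'cV[Qq]_N) \in <<map word ss>>%VS by rewrite hss memvf.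
by rewrite memv_ker lfunE /= => /eqP/colP/(_ i); rewrite -colE !mxE.
Qed.

End Words.
End HighestWeight.

(** * Pairing endomorphisms with L^+ *)

Lemma mx_neq0_entry (U : zmodType) m p (X : 'M[U]_(m, p)) :
  X != 0 -> exists i j, X i j != 0.
Proof.
move=> X0; apply: contrapT => no; case/eqP: X0; apply/matrixP => i j; rewrite mxE.
by apply/eqP/negPn/negP => Xij; apply: no; exists i, j.
Qed.

Lemma sum_mxtens_index (U : nmodType) m p (F : 'I_(m * p) -> U) :
  \sum_k F k = \sum_i \sum_j F (mxtens_index (i, j)).
Proof.
rewrite pair_bigA (reindex (@mxtens_index m p)) /=; first by apply: eq_bigr => -[].
by exists (@mxtens_unindex m p) => x _; rewrite ?mxtens_indexK ?mxtens_unindexK.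
Qed.

Section Legs.
Variables (A : pzRingType) (m : nat) (l l' : 'M[A]_m).
Local Notation "1" := (1%:M : 'M[A]_m).

(** Over a noncommutative ring the Kronecker product is not multiplicative, so the products of the
    two legs are computed by entries; the order of the legs becomes the order of the two factors. *)
Lemma tensmx_leg12 p q : ((l *t 1) *m (1 *t l')) p q =
  l (mxtens_unindex p).1 (mxtens_unindex q).1 * l' (mxtens_unindex p).2 (mxtens_unindex q).2.
Proof.
case: (mxtens_indexP p) => p1 p2; case: (mxtens_indexP q) => q1 q2.
rewrite !mxtens_indexK mxE sum_mxtens_index (bigD1 q1) //= [X in _ + X]big1 ?addr0.
  rewrite (bigD1 p2) //= big1 ?addr0.
    by rewrite !tensmxE !mxE !eqxx mulr1 mul1r.
  by move=> k /negPf kp; rewrite !tensmxE !mxE eq_sym kp mulr0 mul0r.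
move=> k /negPf kq; rewrite big1 // => k' _.
by rewrite !tensmxE !mxE kq mul0r mulr0.
Qed.

Lemma tensmx_leg21 p q : ((1 *t l') *m (l *t 1)) p q =
  l' (mxtens_unindex p).2 (mxtens_unindex q).2 * l (mxtens_unindex p).1 (mxtens_unindex q).1.
Proof.
case: (mxtens_indexP p) => p1 p2; case: (mxtens_indexP q) => q1 q2.
rewrite !mxtens_indexK mxE sum_mxtens_index (bigD1 p1) //= [X in _ + X]big1 ?addr0.
  rewrite (bigD1 q2) //= big1 ?addr0.
    by rewrite !tensmxE !mxE !eqxx mulr1 mul1r.
  by move=> k /negPf kp; rewrite !tensmxE !mxE kp !mulr0.
move=> k /negPf kq; rewrite big1 // => k' _.
by rewrite !tensmxE !mxE eq_sym kq !mul0r.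
Qed.

End Legs.

Section Pairing.
Variable K : comNzRingType.

(* The pairing (A, T) |-> (tr (x) id)(A T) of End(V) with End(V) (x) U. *)
Definition mxtr (U : lmodType K) m (A : 'M[K]_m) (T : 'M[U]_m) : U :=
  \sum_i \sum_j A j i *: T i j.

Section Module.
Variables (U : lmodType K) (m : nat).
Implicit Types (A B P : 'M[K]_m) (T : 'M[U]_m).

Lemma mxtrDl A B T : mxtr (A + B) T = mxtr A T + mxtr B T.
Proof.
rewrite /mxtr -big_split; apply: eq_bigr => i _; rewrite -big_split.
by apply: eq_bigr => j _; rewrite mxE scalerDl.
Qed.

Lemma mxtrZl k A T : mxtr (k *: A) T = k *: mxtr A T.
Proof.
rewrite /mxtr scaler_sumr; apply: eq_bigr => i _; rewrite scaler_sumr.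
by apply: eq_bigr => j _; rewrite mxE scalerA.
Qed.

Lemma mxtr0l T : mxtr 0 T = 0.
Proof. by rewrite -(scale0r 0) mxtrZl scale0r. Qed.

Lemma mxtr_sumr I (s : seq I) A (F : I -> 'M[U]_m) :
  mxtr A (\sum_(i <- s) F i) = \sum_(i <- s) mxtr A (F i).
Proof.
elim: s => [|x s IH].
  by rewrite !big_nil /mxtr big1 // => i _; rewrite big1 // => j _; rewrite mxE scaler0.
rewrite !big_cons -IH /mxtr -big_split; apply: eq_bigr => i _; rewrite -big_split.
by apply: eq_bigr => j _; rewrite mxE scalerDr.
Qed.

Lemma mxtr_mxot A (X : 'M[K]_m) (u : U) : mxtr A (mxot X u) = \tr (A *m X) *: u.
Proof.
rewrite /mxtr exchange_big /mxtrace scaler_suml; apply: eq_bigr => j _.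
by rewrite mxE scaler_suml; apply: eq_bigr => i _; rewrite mxE scalerA.
Qed.

Lemma mxtr_mulr A P T :
  mxtr (A *m P) T = mxtr A (\matrix_(i, j) \sum_k P i k *: T k j).
Proof.
rewrite /mxtr [in RHS]exchange_big [in LHS]exchange_big; apply: eq_bigr => j _.
under eq_bigr do rewrite mxE scaler_suml.
rewrite exchange_big; apply: eq_bigr => k _.
by rewrite mxE scaler_sumr; apply: eq_bigr => i _; rewrite scalerA.
Qed.

(** Cyclicity of the trace, valid because the entries of P are scalars. *)
Lemma mxtr_mull A P T :
  mxtr (P *m A) T = mxtr A (\matrix_(i, j) \sum_k P k j *: T i k).
Proof.
rewrite /mxtr; apply: eq_bigr => i _.
under eq_bigr do rewrite mxE scaler_suml.
rewrite exchange_big; apply: eq_bigr => k _.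
by rewrite mxE scaler_sumr; apply: eq_bigr => j _; rewrite scalerA mulrC.
Qed.

End Module.

Lemma mxtr_neq0 (m : nat) (X : 'M[K]_m) : X != 0 -> exists A, \tr (A *m X) != 0.
Proof.
move=> /mx_neq0_entry[i [j Xij]]; exists (delta_mx j i).
rewrite mxtrace_mulC /mxtrace (bigD1 i) //= big1 => [|k ki].
  rewrite addr0 mxE (bigD1 j) //= big1 => [|l lj].
    by rewrite addr0 mxE !eqxx mulr1.
  by rewrite mxE (negPf lj) mulr0.
rewrite mxE big1 // => l _; by rewrite mxE (negPf ki) andbF mulr0.
Qed.

(** An arbitrary bilinear [mul] covers both x y and y x, and so both sides of the exchange
    relation. *)
Lemma mxtr_tens (U : lmodType K) m p (mul : U -> U -> U)
    (A : 'M[K]_m) (B : 'M[K]_p) (S : 'M[U]_m) (T : 'M[U]_p) :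
  bilin mul ->
  mxtr (A *t B) (\matrix_(x, y)
    mul (S (mxtens_unindex x).1 (mxtens_unindex y).1)
        (T (mxtens_unindex x).2 (mxtens_unindex y).2)) = mul (mxtr A S) (mxtr B T).
Proof.
move=> [mull mulr].
have mul0l b : mul 0 b = 0.
  by have := mull b (-1) 0 0; rewrite scaler0 addr0 scaleN1r addNr.
have mulDl b x y : mul (x + y) b = mul x b + mul y b.
  by have := mull b 1 x y; rewrite !scale1r.
have mulZl b k x : mul (k *: x) b = k *: mul x b.
  by have := mull b k x 0; rewrite !addr0 mul0l addr0.
have mul0r a : mul a 0 = 0.
  by have := mulr a (-1) 0 0; rewrite scaler0 addr0 scaleN1r addNr.
have mulDr a x y : mul a (x + y) = mul a x + mul a y.
  by have := mulr a 1 x y; rewrite !scale1r.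
have mulZr a k x : mul a (k *: x) = k *: mul a x.
  by have := mulr a k x 0; rewrite !addr0 mul0r addr0.
have muls b q (F : 'I_q -> U) : mul (\sum_i F i) b = \sum_i mul (F i) b.
  by apply: (big_morph (mul^~ b)).
have mulrs a q (F : 'I_q -> U) : mul a (\sum_i F i) = \sum_i mul a (F i).
  by apply: (big_morph (mul a)).
rewrite /mxtr sum_mxtens_index muls; apply: eq_bigr => i _.
rewrite mulrs; apply: eq_bigr => i' _.
rewrite sum_mxtens_index muls; apply: eq_bigr => j _.
rewrite mulrs; apply: eq_bigr => j' _.
by rewrite tensmxE mxE !mxtens_indexK mulZl mulZr scalerA.
Qed.

End Pairing.

Section URTheory.
Variables (D : cartan_datum) (n : nat).
Local Notation r := (rank D).
Local Notation N := n.+1.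
Variable pi : {lrmorphism Uq D -> 'M[Qq]_N}.
Variables (R : 'M[Qq]_(N * N)) (mp mm : nat).
Variables (Xp : mp.-tuple 'M[Qq]_N) (Xm : mm.-tuple 'M[Qq]_N).
Local Notation UR := (UR pi R Xp Xm).
Local Notation Fr := (freealg Qq (ur_gens mp mm)).
Local Notation urr := (@ur_rel D n pi R mp mm Xp Xm).
Local Notation pr := (@qproj Qq Fr urr).
Local Notation L := (Lp pi R Xp Xm).

Lemma UR_projM x y : pr (x * y) = pr x * pr y :> UR.
Proof. exact: (qproj_monoid _).2. Qed.
Lemma UR_projD x y : pr (x + y) = pr x + pr y :> UR.
Proof. exact: (raddfD pr). Qed.
Lemma UR_projZ k x : pr (k *: x) = k *: pr x :> UR.
Proof. exact: qproj_scalable. Qed.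
Lemma UR_proj0 : pr 0 = 0 :> UR.
Proof. exact: (raddf0 pr). Qed.
Lemma UR_proj_sum (I : Type) (s : seq I) (P : pred I) (F : I -> Fr) :
  pr (\sum_(i <- s | P i) F i) = \sum_(i <- s | P i) pr (F i) :> UR.
Proof. exact: (big_morph pr UR_projD UR_proj0). Qed.

Lemma UR_scaleAl (k : Qq) (x y : UR) : k *: (x * y) = k *: x * y.
Proof. exact: qalg_scaleAl. Qed.
Lemma UR_scaleAr (k : Qq) (x y : UR) : k *: (x * y) = x * (k *: y).
Proof. exact: qalg_scaleAr. Qed.

Lemma bilin_UR_mul : bilin (fun x y : UR => x * y).
Proof.
split=> [y k x x'|x k y y']; first by rewrite mulrDl -UR_scaleAl.
by rewrite mulrDr -UR_scaleAr.
Qed.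

Lemma bilin_UR_mul_op : bilin (fun x y : UR => y * x).
Proof.
split=> [y k x x'|x k y y']; first by rewrite mulrDr -UR_scaleAr.
by rewrite mulrDl -UR_scaleAl.
Qed.

Lemma UR_proj_fLp i j : pr (fLp mm Xp i j) = L i j.
Proof.
rewrite /fLp /Lp !summxE UR_proj_sum; apply: eq_bigr => k _.
by rewrite !mxE UR_projZ.
Qed.

Lemma LpLp_rel i j :
  \sum_p R i p *: (L (mxtens_unindex p).1 (mxtens_unindex j).1
                 * L (mxtens_unindex p).2 (mxtens_unindex j).2)
  = \sum_p R p j *: (L (mxtens_unindex i).2 (mxtens_unindex p).2
                   * L (mxtens_unindex i).1 (mxtens_unindex p).1).
Proof.
pose l := fLp mm Xp.
have prA k : pr (in_alg Fr k) = k *: (1 : UR) by apply: etrans (UR_projZ k (1 : Fr)) _.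
have h : urr ((map_mx (in_alg Fr) R *m (l *t 1%:M) *m (1%:M *t l)) i j
    - ((1%:M *t l) *m (l *t 1%:M) *m map_mx (in_alg Fr) R) i j).
  have := @ur_pp D n pi R mp mm Xp Xm i j.
  by rewrite [X in urr X -> _]mxE [X in urr (_ + X) -> _]mxE.
have lhs : pr ((map_mx (in_alg Fr) R *m (l *t 1%:M) *m (1%:M *t l)) i j) =
  \sum_p R i p *: (L (mxtens_unindex p).1 (mxtens_unindex j).1
                 * L (mxtens_unindex p).2 (mxtens_unindex j).2).
  rewrite -mulmxA mxE UR_proj_sum; apply: eq_bigr => p _.
  rewrite (UR_projM (map_mx (in_alg Fr) R i p)) tensmx_leg12 [in pr (map_mx _ _ _ _)]mxE prA.
  by rewrite UR_projM !UR_proj_fLp -UR_scaleAl mul1r.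
have rhs : pr (((1%:M *t l) *m (l *t 1%:M) *m map_mx (in_alg Fr) R) i j) =
  \sum_p R p j *: (L (mxtens_unindex i).2 (mxtens_unindex p).2
                 * L (mxtens_unindex i).1 (mxtens_unindex p).1).
  rewrite mxE UR_proj_sum; apply: eq_bigr => p _.
  rewrite (UR_projM _ (map_mx (in_alg Fr) R p j)) tensmx_leg21 [in pr (map_mx _ _ _ _)]mxE prA.
  by rewrite UR_projM !UR_proj_fLp -UR_scaleAr mulr1.
by rewrite -lhs -rhs; apply: qproj_eq.
Qed.

(** Moving R across the trace onto the test matrix leaves only L_1 L_2 and L_2 L_1, whose pairings
    with Kronecker products factor by [mxtr_tens]. *)
Lemma mxtr_LpLp_rel (Y : 'M[Qq]_(N * N)) :
  mxtr (Y *m R) (\matrix_(x, y) (L (mxtens_unindex x).1 (mxtens_unindex y).1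
                               * L (mxtens_unindex x).2 (mxtens_unindex y).2))
  = mxtr (R *m Y) (\matrix_(x, y) (L (mxtens_unindex x).2 (mxtens_unindex y).2
                               * L (mxtens_unindex x).1 (mxtens_unindex y).1)).
Proof.
rewrite mxtr_mulr mxtr_mull; congr mxtr; apply/matrixP => i j; rewrite !mxE.
under eq_bigr do rewrite mxE.
under [RHS]eq_bigr do rewrite mxE.
exact: LpLp_rel.
Qed.

End URTheory.

(** * Weight components of L^+ *)

Section Blocks.
Variables (D : cartan_datum) (n : nat).
Local Notation r := (rank D).
Local Notation N := n.+1.
Variable pi : {lrmorphism Uq D -> 'M[Qq]_N}.
Variables (R : 'M[Qq]_(N * N)) (mp mm : nat).
Variables (Xp : mp.-tuple 'M[Qq]_N) (Xm : mm.-tuple 'M[Qq]_N).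
Local Notation UR := (UR pi R Xp Xm).
Local Notation Fr := (freealg Qq (ur_gens mp mm)).
Local Notation urr := (@ur_rel D n pi R mp mm Xp Xm).
Local Notation pr := (@qproj Qq Fr urr).
Local Notation L := (Lp pi R Xp Xm).
Local Notation P := (wproj pi).
Hypothesis pi_type1 : type1_module pi.
Hypothesis hXp : basis_of_sum pi (@Qplus D) Xp.
Variable ell : 'rV[rat]_r -> UR.
Hypothesis hell : is_ell ell.
Implicit Types (mu ka ga : 'rV[rat]_r) (A : 'M[Qq]_N).

(** A maps V_ka to V_mu, so its trace against an endomorphism of degree b vanishes unless ka = mu +
    b, and L^+ has only degrees in Q_+. *)
Lemma mxtr_Lp_block A mu ka : weight_lattice mu -> weight_lattice ka ->
  A = P mu *m A *m P ka -> mxtr A L != 0 -> exists2 b, Qplus b & ka = mu + rootQ b.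
Proof.
move=> wmu wka AE; apply: contra_neqP => no.
rewrite /Lp mxtr_sumr big1 // => k _; rewrite mxtr_mxot.
suff -> : \tr (A *m tnth Xp k) = 0 by rewrite scale0r.
have /hXp.2[s [hs ->]] : tnth Xp k \in <<Xp>>%VS by rewrite memv_span // mem_tnth.
rewrite mulmx_sumr raddf_sum big_seq big1 //= => Y /hs[b Qb /homog_EndV hY].
rewrite AE mxtrace_mulC !mulmxA (wproj_homog pi_type1 hY wmu) -!mulmxA mxtrace_mulC.
rewrite -!mulmxA wprojM //; last exact: weightD (weight_rootQ _).
by case: eqP => [e|_]; [case: no; exists b | rewrite !mulmx0 mxtrace0].
Qed.

Lemma sum_wproj_block (U : zmodType) A mu (f : 'M[Qq]_N -> 'rV[rat]_r -> U) :
  wt pi mu -> A = P mu *m A *m P mu -> (forall ga, f 0 ga = 0) ->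
  \sum_(ga \in wt pi) f (P ga *m A *m P ga) ga = f A mu /\
  \sum_(ga \in wt pi) f (A *m P ga) ga = f A mu /\
  \sum_(ga \in wt pi) f (P ga *m A) ga = f A mu.
Proof.
move=> wtmu AE f0; have wmu := wt_lattice wtmu.
have PP := wproj_idem pi_type1 wmu.
have AP : A *m P mu = A by rewrite AE -!mulmxA PP.
have PA : P mu *m A = A by rewrite {1}AE !mulmxA PP -AE.
have AP0 ga : wt pi ga -> ga != mu -> A *m P ga = 0.
  move=> wtga gm; rewrite -AP -mulmxA wprojM ?(negPf gm) ?mulmx0 //.
  exact: wt_lattice wtga.
have PA0 ga : wt pi ga -> ga != mu -> P ga *m A = 0.
  move=> wtga gm; rewrite -PA mulmxA wprojM //.
  by rewrite eq_sym (negPf gm) mul0mx.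
split; first by rewrite (wt_sum_delta pi_type1 wtmu) ?PA ?AP // => ga wga gm; rewrite PA0 ?mul0mx.
split; first by rewrite (wt_sum_delta pi_type1 wtmu) ?AP // => ga wga gm; rewrite AP0.
by rewrite (wt_sum_delta pi_type1 wtmu) ?PA // => ga wga gm; rewrite PA0.
Qed.

Lemma mxcomp0E (U : lmodType Qq) (T : 'M[U]_N) i j :
  mxcomp pi 0 T i j = \sum_(ga <- fset_set (wt pi))
    \sum_k \sum_l (P ga i k * P ga l j) *: T k l.
Proof.
rewrite /mxcomp wt_sumE // summxE; apply: eq_bigr => ga _.
by rewrite mxE rootQ0 addr0.
Qed.

(** The projection onto degree zero blocks is self-adjoint for the trace pairing. *)
Lemma mxtr_mxcomp0 (U : lmodType Qq) (T : 'M[U]_N) A :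
  mxtr A (mxcomp pi 0 T) = \sum_(ga \in wt pi) mxtr (P ga *m A *m P ga) T.
Proof.
rewrite /mxcomp !wt_sumE // mxtr_sumr; apply: eq_bigr => ga _.
rewrite -mulmxA mxtr_mull mxtr_mulr; congr mxtr; apply/matrixP => i j.
rewrite !mxE rootQ0 addr0; apply: eq_bigr => k _; rewrite mxE scaler_sumr.
by apply: eq_bigr => l _; rewrite scalerA.
Qed.

Lemma mxtr_Lp_diag A mu : wt pi mu -> A = P mu *m A *m P mu ->
  mxtr A L = \tr A *: ell mu.
Proof.
move=> wtmu AE.
have [h1 _] := sum_wproj_block (f := fun B _ => mxtr B L) wtmu AE (fun _ => mxtr0l _).
have [_ [h2 _]] := sum_wproj_block (f := fun B ga => \tr B *: ell ga) wtmu AE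
  (fun ga => etrans (congr1 (fun t => t *: ell ga) (mxtrace0 _ _)) (scale0r _)).
rewrite -h1 -h2 -mxtr_mxcomp0 hell !wt_sumE // mxtr_sumr; apply: eq_bigr => ga _.
by rewrite mxtr_mxot.
Qed.

Lemma mxtr_lmul (u : UR) A (T : 'M[UR]_N) :
  mxtr A (\matrix_(i, j) (u * T i j)) = u * mxtr A T.
Proof.
rewrite /mxtr mulr_sumr; apply: eq_bigr => i _; rewrite mulr_sumr.
by apply: eq_bigr => j _; rewrite mxE UR_scaleAr.
Qed.

Lemma mxtr_rmul (u : UR) A (T : 'M[UR]_N) :
  mxtr A (\matrix_(i, j) (T i j * u)) = mxtr A T * u.
Proof.
rewrite /mxtr mulr_suml; apply: eq_bigr => i _; rewrite mulr_suml.
by apply: eq_bigr => j _; rewrite mxE UR_scaleAl.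
Qed.

Lemma UR_proj_mxcomp0 (T : 'M[Fr]_N) i j :
  pr (mxcomp pi 0 T i j) = mxcomp pi 0 (\matrix_(k, l) (pr (T k l) : UR)) i j.
Proof.
rewrite !mxcomp0E UR_proj_sum; apply: eq_bigr => ga _; rewrite UR_proj_sum; apply: eq_bigr => k _.
by rewrite UR_proj_sum; apply: eq_bigr => l _; rewrite UR_projZ mxE.
Qed.

Lemma UR_proj_mxcomp0_fLp i j : pr (mxcomp pi 0 (fLp mm Xp) i j) =
  \sum_(ga <- fset_set (wt pi)) P ga i j *: ell ga.
Proof.
rewrite UR_proj_mxcomp0; have -> : \matrix_(k, l) (pr (fLp mm Xp k l) : UR) = L.
  by apply/matrixP => k l; rewrite mxE UR_proj_fLp.
by rewrite hell wt_sumE // summxE; apply: eq_bigr => ga _; rewrite mxE.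
Qed.

(** Makes [ring_inv (ell mu)] a genuine inverse rather than the default value. Pairing the two
    relations between the degree zero parts of L^+ and L^- with a trace one matrix A in the block of
    mu turns the factor from L^+ into [ell mu]; the remaining factor, A paired with the degree zero
    part of L^-, is the inverse. *)
Lemma ell_unit mu : wt pi mu -> exists y, ell mu * y = 1 /\ y * ell mu = 1.
Proof.
move=> wtmu; have wmu := wt_lattice wtmu.
have [C trC] := mxtr_neq0 (wproj_neq0 pi_type1 wtmu).
(* The normalization uses that compressing C to the block of mu leaves its trace against [P mu]
   unchanged. *)
pose A := (\tr (C *m P mu))^-1 *: (P mu *m C *m P mu).
have PP := wproj_idem pi_type1 wmu.
have AE : A = P mu *m A *m P mu.
  by rewrite /A -scalemxAr -scalemxAl !mulmxA PP -!mulmxA PP.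
have trA : \tr A = 1.
  by rewrite /A mxtraceZ [X in _ * X]mxtrace_mulC mulmxA PP (mxtrace_mulC (P mu)) mulVf.
pose M := \matrix_(k, l) (pr (mxcomp pi 0 (fLm mp Xm) k l) : UR).
pose I := \matrix_(k, l) ((k == l)%:R : UR) : 'M[UR]_N.
have trI : mxtr A I = 1.
  rewrite /mxtr -[RHS]scale1r -trA scaler_suml; apply: eq_bigr => i _.
  rewrite (bigD1 i) //= big1 => [|j ji]; first by rewrite addr0 [I i i]mxE eqxx.
  by rewrite [I i j]mxE eq_sym (negPf ji) scaler0.
have one_entry i j : pr ((1%:M : 'M[Fr]_N) i j) = I i j.
  by rewrite !mxE; case: eqP => _; [exact: (qproj_monoid _).1 | exact: UR_proj0].
pose ws := fset_set (wt pi).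
pose TL ga := \matrix_(i, j) (\sum_k P ga i k *: M k j) : 'M[UR]_N.
pose TR ga := \matrix_(i, j) (\sum_k P ga k j *: M i k) : 'M[UR]_N.
have IL : I = \sum_(ga <- ws) \matrix_(i, j) (ell ga * TL ga i j).
  apply/matrixP => i j; rewrite summxE -one_entry.
  have := @ur_pm0 D n pi R mp mm Xp Xm i j.
  rewrite [X in urr X -> _]mxE [X in urr (_ + X) -> _]mxE => /qproj_eq <-.
  under [RHS]eq_bigr do rewrite !mxE mulr_sumr.
  rewrite [RHS]exchange_big mxE UR_proj_sum; apply: eq_bigr => k _.
  apply: etrans (@UR_projM _ _ pi R _ _ Xp Xm _ _) _.
  apply: etrans (congr1 (fun x : UR => x * _) (UR_proj_mxcomp0_fLp i k)) _.
  rewrite mulr_suml; apply: eq_bigr => ga _.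
  by rewrite [M k j]mxE -UR_scaleAl UR_scaleAr.
have IR : I = \sum_(ga <- ws) \matrix_(i, j) (TR ga i j * ell ga).
  apply/matrixP => i j; rewrite summxE -one_entry.
  have := @ur_mp0 D n pi R mp mm Xp Xm i j.
  rewrite [X in urr X -> _]mxE [X in urr (_ + X) -> _]mxE => /qproj_eq <-.
  under [RHS]eq_bigr do rewrite !mxE mulr_suml.
  rewrite [RHS]exchange_big mxE UR_proj_sum; apply: eq_bigr => k _.
  apply: etrans (@UR_projM _ _ pi R _ _ Xp Xm _ _) _.
  apply: etrans (congr1 (fun x : UR => _ * x) (UR_proj_mxcomp0_fLp k j)) _.
  rewrite mulr_sumr; apply: eq_bigr => ga _.
  by rewrite [M i k]mxE -UR_scaleAl UR_scaleAr.
have [_ [hr _]] := sum_wproj_block (f := fun B ga => ell ga * mxtr B M) wtmu AE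
  (fun ga => etrans (congr1 (fun t => ell ga * t) (mxtr0l _)) (mulr0 _)).
have [_ [_ hl]] := sum_wproj_block (f := fun B ga => mxtr B M * ell ga) wtmu AE
  (fun ga => etrans (congr1 (fun t => t * ell ga) (mxtr0l _)) (mul0r _)).
exists (mxtr A M); split.
  rewrite -hr -trI IL mxtr_sumr wt_sumE //; apply: eq_bigr => ga _.
  by rewrite mxtr_lmul mxtr_mulr.
rewrite -hl -trI IR mxtr_sumr wt_sumE //; apply: eq_bigr => ga _.
by rewrite mxtr_rmul mxtr_mull.
Qed.

End Blocks.

(** * The exchange relation for the elements ell *)

Lemma scaler_cancel (K : fieldType) (U : lmodType K) (c : K) (x y : U) :
  c != 0 -> c *: x = c *: y -> x = y.
Proof. by move=> c0 /(congr1 ( *:%R c^-1)); rewrite !scalerA mulVf // !scale1r. Qed.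

Lemma mxtrace_cycle (K : comPzRingType) m (A B C X : 'M[K]_m) :
  \tr (A *m B *m C *m X) = \tr (B *m (C *m X *m A)).
Proof. by rewrite -!mulmxA mxtrace_mulC !mulmxA. Qed.

Section RMatrix.
Variables (D : cartan_datum) (n : nat).
Local Notation r := (rank D).
Local Notation N := n.+1.
Variables (pi : {lrmorphism Uq D -> 'M[Qq]_N}) (lam : 'rV[rat]_r).
Variables (Delta : Uq D -> UqUq D) (Psi : UqUq D -> UqUq D) (Rp : 'rV[int]_r -> UqUq D).
Hypothesis pi_type1 : type1_module pi.
Hypothesis hRp : is_Rplus Delta Psi Rp.
Local Notation P := (wproj pi).
Local Notation pi2 := (tlift (fun a b => pi a *t pi b)).
Implicit Types (mu ka de ga : 'rV[rat]_r) (A B : 'M[Qq]_N).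

Lemma bilin_pi2 : bilin (fun a b => pi a *t pi b).
Proof.
split=> [b|a] k x y; apply/matrixP => i j; rewrite raddfD /= piZ !mxE.
  by rewrite mulrDl mulrA.
by rewrite mulrDr mulrCA.
Qed.

Lemma pi2_pure a b : pi2 (tpure a b) = pi a *t pi b.
Proof. exact: tlift_pure bilin_pi2. Qed.

Lemma pi2_Rp nu : Qplus nu -> exists2 s : seq (Uq D * Uq D),
  (forall p, p \in s -> Uq_deg nu p.1 /\ Uq_deg (- nu) p.2) &
  pi2 (Rp nu) = \sum_(p <- s) pi p.1 *t pi p.2.
Proof.
have [h _ _ _] := hRp; move=> /h[s [hs ->]]; exists s.
  by move=> p /hs[[_ ?] [_ ?]].
by rewrite -tens_piE (tlift_pi _ bilin_pi2).
Qed.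

Lemma pi_deg_neq0 nu (a : Uq D) : Uq_deg nu a -> pi a != 0 ->
  exists mu, wt pi mu /\ wt pi (mu + rootQ nu).
Proof.
move=> da a0; apply: contrapT => no; case/eqP: a0; apply: (eq_on_weights pi_type1).
move=> mu w wtmu hw; rewrite mul0mx; apply: contrapT => /eqP aw; apply: no.
exists mu; split=> //; apply: neq0_wt (homog_pi da (wt_lattice wtmu) hw) aw.
exact: weightD (wt_lattice wtmu) (weight_rootQ _).
Qed.

(** A nonzero component forces nu to be a difference of two weights. Finiteness matters because the
    sum over Q_+ in [Rmx] is a genuine sum only when its support is finite. *)
Lemma finite_Rp_support : finite_set [set nu | Qplus nu /\ pi2 (Rp nu) != 0].
Proof.
pose W : seq _ := fset_set (wt pi).
(* Taking numerators inverts [rootQ] on integral vectors. *)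
pose back (x : 'rV[rat]_r) : 'rV[int]_r := map_mx numq x.
apply: (@sub_finite_set _ _ [set` [seq back (x - y) | x <- W, y <- W]]); last exact: finite_seq.
move=> nu [/pi2_Rp[s hs ->] s0] /=.
have [p ps p0] : exists2 p, p \in s & pi p.1 != 0.
  apply: contrapT => no; case/eqP: s0; rewrite big_seq big1 // => p ps.
  have [->|p0] := eqVneq (pi p.1) 0; first exact: tens0mx.
  by case: no; exists p.
have [mu [wtmu wtnu]] := pi_deg_neq0 (hs p ps).1 p0.
apply/allpairsP; exists (mu + rootQ nu, mu).
split; rewrite /= ?(mem_wts pi_type1); try exact/asboolP.
by rewrite addrAC subrr add0r; apply/rowP => i; rewrite !mxE numq_int.
Qed.

Lemma Rp_sum_single (U : zmodType) (f : 'M[Qq]_(N * N) -> U) nu0 :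
  {morph f : x y / x + y} -> f 0 = 0 -> Qplus nu0 ->
  (forall nu, Qplus nu -> nu != nu0 -> f (pi2 (Rp nu)) = 0) ->
  f (\sum_(nu \in @Qplus D) pi2 (Rp nu)) = f (pi2 (Rp nu0)).
Proof.
(* [nu0] is added by hand, since its own component may be zero. *)
move=> fD f0 Q0 fz; pose S := [set nu | Qplus nu /\ pi2 (Rp nu) != 0] `|` [set nu0].
have finS : finite_set S by rewrite finite_setU; split=> //; exact: finite_Rp_support.
have inS nu : (nu \in fset_set S) = `[< S nu >].
  by rewrite in_fset_set //; apply/idP/asboolP => [/set_mem|/mem_set].
have SQ nu : S nu -> Qplus nu by case=> [[]|->].
rewrite (fsbigE (fset_set S)); first last.
- move=> nu Qnu; rewrite inS => /asboolP nS; apply: contrapT => /eqP nz.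
  by apply: nS; left.
- by move=> nu /=; rewrite inS => /asboolP/SQ.
- exact: fset_uniq.
rewrite (big_morph f fD f0) big_mkcond (bigD1_seq nu0) ?fset_uniq //=; last first.
  by rewrite inS; apply/asboolP; right.
rewrite mem_set // big_seq_cond big1 ?addr0 // => nu /andP[].
by rewrite inS => /asboolP/SQ Qnu ne; rewrite mem_set // fz.
Qed.

Lemma Dmx_mulr ka de A B : weight_lattice ka -> weight_lattice de ->
  A *m P ka = A -> B *m P de = B ->
  (A *t B) *m Dmx pi lam = qpow (form ka de - form lam lam) *: (A *t B).
Proof.
move=> wka wde hA hB.
(* If [ka] or [de] is not a weight, [Dmx] has no matching term, but then A or B is zero. *)
have [wtka|/(wproj_not_wt pi_type1 wka) k0] := pselect (wt pi ka); last first.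
  by rewrite -hA k0 mulmx0 tens0mx mul0mx scaler0.
have [wtde|/(wproj_not_wt pi_type1 wde) d0] := pselect (wt pi de); last first.
  by rewrite -hB d0 mulmx0 tensmx0 mul0mx scaler0.
have A0 mu : wt pi mu -> mu != ka -> A *m P mu = 0.
  move=> wtmu ne; rewrite -hA -mulmxA wprojM //; last exact: wt_lattice wtmu.
  by rewrite (negPf ne) mulmx0.
have B0 mu : wt pi mu -> mu != de -> B *m P mu = 0.
  move=> wtmu ne; rewrite -hB -mulmxA wprojM //; last exact: wt_lattice wtmu.
  by rewrite (negPf ne) mulmx0.
rewrite /Dmx (wt_sumE pi_type1) mulmx_sumr -(wt_sumE pi_type1 (fun mu => (A *t B) *m _)).
rewrite (wt_sum_delta pi_type1 wtka) => [|mu wtmu ne].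
  rewrite (wt_sumE pi_type1) mulmx_sumr -(wt_sumE pi_type1 (fun mu => (A *t B) *m _)).
  rewrite (wt_sum_delta pi_type1 wtde) => [|mu wtmu ne].
    by rewrite -scalemxAr tensmx_mul hA hB.
  by rewrite -scalemxAr tensmx_mul (B0 mu) // tensmx0 scaler0.
rewrite (wt_sumE pi_type1) mulmx_sumr big1 // => ga _.
by rewrite -scalemxAr tensmx_mul (A0 mu) // tens0mx scaler0.
Qed.

Lemma Dmx_mull ka de A B : weight_lattice ka -> weight_lattice de ->
  P ka *m A = A -> P de *m B = B ->
  Dmx pi lam *m (A *t B) = qpow (form ka de - form lam lam) *: (A *t B).
Proof.
move=> wka wde hA hB.
have Pk := wproj_idem pi_type1 wka; have Pd := wproj_idem pi_type1 wde.
have AB : A *t B = (P ka *t P de) *m (A *t B) by rewrite tensmx_mul hA hB.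
suff comm : Dmx pi lam *m (P ka *t P de) = (P ka *t P de) *m Dmx pi lam.
  by rewrite [in LHS]AB mulmxA comm (Dmx_mulr wka wde Pk Pd) -scalemxAl -AB.
rewrite /Dmx (wt_sumE pi_type1) mulmx_sumr mulmx_suml; apply: eq_big_seq => mu.
rewrite (mem_wts pi_type1) => /asboolP /wt_lattice wmu.
rewrite (wt_sumE pi_type1) mulmx_sumr mulmx_suml; apply: eq_big_seq => ga.
rewrite (mem_wts pi_type1) => /asboolP /wt_lattice wga.
rewrite -scalemxAl -scalemxAr; congr (_ *: _).
rewrite 2!tensmx_mul (wprojM pi_type1 mu wka) (wprojM pi_type1 ga wde).
rewrite (wprojM pi_type1 ka wmu) (wprojM pi_type1 de wga) (eq_sym ka) (eq_sym de).
by case: eqP => [->|_]; case: eqP => [->|_]; rewrite ?tens0mx ?tensmx0.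
Qed.

Section Exchange.
Variables (mp mm : nat) (Xp : mp.-tuple 'M[Qq]_N) (Xm : mm.-tuple 'M[Qq]_N).
Local Notation UR := (UR pi (Rmx pi lam Rp) Xp Xm).
Local Notation L := (Lp pi (Rmx pi lam Rp) Xp Xm).
Hypothesis hXp : basis_of_sum pi (@Qplus D) Xp.
Variable ell : 'rV[rat]_r -> UR.
Hypothesis hell : is_ell ell.

Lemma Qplus_antisym (b c nu nu0 : 'rV[int]_r) : Qplus b -> Qplus c ->
  b = nu0 - nu -> c = nu - nu0 -> nu = nu0.
Proof.
move=> Qb Qc bE cE; apply/rowP => i; move: (Qb i) (Qc i).
by rewrite bE cE !mxE !subr_ge0 => h1 h2; apply/eqP; rewrite eq_le h1 h2.
Qed.

(** Stated for any nu0 whose component of R^+ is a nonzero multiple of one tensor on V (x) V; the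
    cases of interest are nu0 = 0 and nu0 = alpha_i. *)
Lemma ell_exchange nu0 k a b mu ga : Qplus nu0 ->
  Uq_deg nu0 a -> Uq_deg (- nu0) b -> pi2 (Rp nu0) = k *: (pi a *t pi b) -> k != 0 ->
  wt pi mu -> wt pi ga -> wt pi (mu + rootQ nu0) -> wt pi (ga - rootQ nu0) ->
  P (mu + rootQ nu0) *m pi a *m P mu != 0 -> P (ga - rootQ nu0) *m pi b *m P ga != 0 ->
  ell mu * ell ga = ell (ga - rootQ nu0) * ell (mu + rootQ nu0).
Proof.
move=> Q0 da db Rk k0 wtmu wtga wtmu' wtga' /mxtr_neq0[A0 trA] /mxtr_neq0[B0 trB].
set mu' := mu + rootQ nu0 in wtmu' trA *; set ga' := ga - rootQ nu0 in wtga' trB *.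
have [wmu wga] := (wt_lattice wtmu, wt_lattice wtga).
have [wmu' wga'] := (wt_lattice wtmu', wt_lattice wtga').
(* The test matrices run against a and b, from V_mu' to V_mu and from V_ga' to V_ga, so that A a and
   B b are diagonal blocks with nonzero trace. *)
pose A := P mu *m A0 *m P mu'; pose B := P ga *m B0 *m P ga'.
have PP := wproj_idem pi_type1.
have AP : A *m P mu' = A by rewrite /A -mulmxA PP.
have BP : B *m P ga' = B by rewrite /B -mulmxA PP.
have PA : P mu *m A = A by rewrite /A !mulmxA PP.
have PB : P ga *m B = B by rewrite /B !mulmxA PP.
have trAa : \tr (A *m pi a) != 0 by rewrite /A mxtrace_cycle; exact: trA.
have trBb : \tr (B *m pi b) != 0 by rewrite /B mxtrace_cycle; exact: trB.
clearbody A B.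
pose T12 := \matrix_(x, y) (L (mxtens_unindex x).1 (mxtens_unindex y).1
                           * L (mxtens_unindex x).2 (mxtens_unindex y).2).
pose T21 := \matrix_(x, y) (L (mxtens_unindex x).2 (mxtens_unindex y).2
                           * L (mxtens_unindex x).1 (mxtens_unindex y).1).
have T12E X Z : mxtr (X *t Z) T12 = mxtr X L * mxtr Z L.
  exact: (mxtr_tens _ _ _ _ (bilin_UR_mul _ _ _ _)).
have T21E X Z : mxtr (X *t Z) T21 = mxtr Z L * mxtr X L.
  exact: (mxtr_tens _ _ _ _ (bilin_UR_mul_op _ _ _ _)).
pose qq := qpow (form mu' ga' - form lam lam).
pose f X := mxtr ((A *t B) *m Dmx pi lam *m X) T12.
pose g X := mxtr (Dmx pi lam *m X *m (A *t B)) T21.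
have fD : {morph f : x y / x + y} by move=> x y; rewrite /f mulmxDr mxtrDl.
have gD : {morph g : x y / x + y} by move=> x y; rewrite /g mulmxDr mulmxDl mxtrDl.
have f0 : f 0 = 0 by rewrite /f mulmx0 mxtr0l.
have g0 : g 0 = 0 by rewrite /g mulmx0 mul0mx mxtr0l.
have fE x y : f (x *t y) = qq *: (mxtr (A *m x) L * mxtr (B *m y) L).
  rewrite /f (Dmx_mulr wmu' wga' AP BP) -scalemxAl mxtrZl tensmx_mul.
  by rewrite T12E.
have gE nu x y : Uq_deg nu x -> Uq_deg (- nu) y -> g (pi x *t pi y) =
    qpow (form (mu + rootQ nu) (ga + rootQ (- nu)) - form lam lam) *:
      (mxtr (pi y *m B) L * mxtr (pi x *m A) L).
  move=> /(homog_pi (pi := pi)) hx /(homog_pi (pi := pi)) hy.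
  rewrite /g -mulmxA tensmx_mul (@Dmx_mull (mu + rootQ nu) (ga + rootQ (- nu))).
  - by rewrite mxtrZl T21E.
  - exact: weightD (weight_rootQ _).
  - exact: weightD (weight_rootQ _).
  - by rewrite mulmxA -(wproj_homog pi_type1 hx wmu) -mulmxA PA.
  - by rewrite mulmxA -(wproj_homog pi_type1 hy wga) -mulmxA PB.
have relY : f (\sum_(nu \in @Qplus D) pi2 (Rp nu)) = g (\sum_(nu \in @Qplus D) pi2 (Rp nu)).
  by rewrite /f /g -(mulmxA (A *t B)); exact: (@mxtr_LpLp_rel _ _ pi _ _ _ Xp Xm (A *t B)).
have fZ x : f (k *: x) = k *: f x by rewrite /f -scalemxAr mxtrZl.
have gZ x : g (k *: x) = k *: g x by rewrite /g -scalemxAr -scalemxAl mxtrZl.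
clearbody f g T12 T21.
(* The elements [d] and [e] obtained from the two legs are nu0 - nu and nu - nu0. *)
have fz nu : Qplus nu -> nu != nu0 -> f (pi2 (Rp nu)) = 0.
  move=> /pi2_Rp[s hs ->] ne; rewrite (big_morph f fD f0) big_seq big1 // => -[x y].
  move=> /hs[/= /(homog_pi (pi := pi)) hx /(homog_pi (pi := pi)) hy]; rewrite fE.
  have block (w w' : 'rV[rat]_r) C X c : weight_lattice w -> weight_lattice w' ->
      homog pi c X -> P w *m C = C -> C *m P w' = C -> mxtr (C *m X) L != 0 ->
      exists2 d, Qplus d & w' - rootQ c = w + rootQ d.
    move=> ww ww' hX PC CP; apply: mxtr_Lp_block => //.
      by apply: weightD => //; exact/weightN/weight_rootQ.
    rewrite !mulmxA PC -mulmxA (wproj_homog pi_type1 hX) ?subrK ?mulmxA ?CP //.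
    by apply: weightD => //; exact/weightN/weight_rootQ.
  have [->|/(block _ _ _ _ _ wmu wmu' hx PA AP)[d Qd dE]] := eqVneq (mxtr (A *m pi x) L) 0.
    by rewrite mul0r scaler0.
  have [->|/(block _ _ _ _ _ wga wga' hy PB BP)[e Qe eE]] := eqVneq (mxtr (B *m pi y) L) 0.
    by rewrite mulr0 scaler0.
  case/eqP: ne; apply: (Qplus_antisym Qd Qe); apply/rootQ_inj.
    by move/eqP: dE; rewrite rootQB /mu' -addrA (inj_eq (addrI _)) => /eqP.
  by move/eqP: eE; rewrite rootQN rootQB /ga' opprK -addrA (inj_eq (addrI _)) addrC => /eqP.
have gz nu : Qplus nu -> nu != nu0 -> g (pi2 (Rp nu)) = 0.
  move=> /pi2_Rp[s hs ->] ne; rewrite (big_morph g gD g0) big_seq big1 // => -[x y].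
  move=> /hs[/= dx dy]; rewrite (gE nu) //.
  have [hx hy] := (homog_pi (pi := pi) dx, homog_pi (pi := pi) dy).
  have block (w w' : 'rV[rat]_r) C X c : weight_lattice w -> weight_lattice w' ->
      homog pi c X -> P w *m C = C -> C *m P w' = C -> mxtr (X *m C) L != 0 ->
      exists2 d, Qplus d & w' = w + rootQ c + rootQ d.
    move=> ww ww' hX PC CP; apply: mxtr_Lp_block => //.
      exact: weightD (weight_rootQ _).
    by rewrite -!mulmxA CP mulmxA -(wproj_homog pi_type1 hX) // -mulmxA PC.
  have [->|/(block _ _ _ _ _ wmu wmu' hx PA AP)[d Qd dE]] := eqVneq (mxtr (pi x *m A) L) 0.
    by rewrite mulr0 scaler0.
  have [->|/(block _ _ _ _ _ wga wga' hy PB BP)[e Qe eE]] := eqVneq (mxtr (pi y *m B) L) 0.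
    by rewrite mul0r scaler0.
  case/eqP: ne; apply: (Qplus_antisym Qd Qe); apply/rootQ_inj.
    move/eqP: dE; rewrite rootQB /mu' -addrA (inj_eq (addrI _)) => /eqP ->.
    by rewrite addrAC subrr add0r.
  move/eqP: eE; rewrite rootQB rootQN /ga' -addrA (inj_eq (addrI _)) => /eqP e0.
  by rewrite -[rootQ e](addKr (- rootQ nu)) -e0 opprK.
move: relY; rewrite !(Rp_sum_single _ _ Q0) // Rk.
have [ha hb] := (homog_pi (pi := pi) da, homog_pi (pi := pi) db).
rewrite fZ gZ fE (gE nu0 _ _ da db) rootQN.
(* On the left D acts on the source of A (x) B, on the right on the target of R^+ (A (x) B); at nu0
   both are V_mu' (x) V_ga', so the powers of q cancel. *)
have -> : qpow (form (mu + rootQ nu0) (ga - rootQ nu0) - form lam lam) = qq by [].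
have qq0 : qq != 0 by apply: qpow_neq0.
clearbody qq.
have diag A1 w : wt pi w -> P w *m A1 = A1 -> A1 *m P w = A1 -> mxtr A1 L = \tr A1 *: ell w.
  by move=> wtw h1 h2; apply: mxtr_Lp_diag => //; rewrite h1 h2.
have d1 : mxtr (A *m pi a) L = \tr (A *m pi a) *: ell mu.
  apply: diag wtmu _ _; first by rewrite mulmxA PA.
  by rewrite -mulmxA (wproj_homog pi_type1 ha wmu) mulmxA AP.
have d2 : mxtr (B *m pi b) L = \tr (B *m pi b) *: ell ga.
  apply: diag wtga _ _; first by rewrite mulmxA PB.
  by rewrite -mulmxA (wproj_homog pi_type1 hb wga) rootQN mulmxA BP.
have d3 : mxtr (pi a *m A) L = \tr (A *m pi a) *: ell mu'.
  rewrite mxtrace_mulC; apply: diag wtmu' _ _; last by rewrite -mulmxA AP.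
  by rewrite mulmxA -(wproj_homog pi_type1 ha wmu) -mulmxA PA.
have d4 : mxtr (pi b *m B) L = \tr (B *m pi b) *: ell ga'.
  rewrite mxtrace_mulC; apply: diag wtga' _ _; last by rewrite -mulmxA BP.
  by rewrite mulmxA /ga' -rootQN -(wproj_homog pi_type1 hb wga) -mulmxA PB.
rewrite d1 d2 d3 d4.
move: (\tr (A *m pi a)) (\tr (B *m pi b)) trAa trBb => ta tb ta0 tb0.
have scaleM (s t : Qq) (x y : UR) : (s *: x) * (t *: y) = (s * t) *: (x * y).
  by rewrite -UR_scaleAl -UR_scaleAr scalerA.
rewrite !scaleM !scalerA (mulrC tb ta) => h.
exact: (scaler_cancel (mulf_neq0 k0 (mulf_neq0 qq0 (mulf_neq0 ta0 tb0))) h).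
Qed.


End Exchange.
End RMatrix.

(** * The component of R^+ of degree alpha_i *)

Section Degree.
Variable D : cartan_datum.
Local Notation r := (rank D).
Implicit Types (x y z : Uq D) (b g : 'rV[int]_r).

Lemma Uq_degD g x y : Uq_deg g x -> Uq_deg g y -> Uq_deg g (x + y).
Proof. by move=> dx dy b; rewrite mulrDr mulrDl dx dy scalerDr. Qed.

Lemma Uq_degZ g k x : Uq_deg g x -> Uq_deg g (k *: x).
Proof. by move=> dx b; rewrite -scalerAr -scalerAl dx !scalerA mulrC. Qed.

(** Independence of the graded pieces, by induction on the number of summands: for b separating g0
    from [g i], conjugation by K_b minus its eigenvalue on [y i] kills that summand, rescales the
    others, and multiplies z by a nonzero scalar. *)
Lemma Uq_deg_sum_eq0 (I : eqType) (s : seq I) (y : I -> Uq D) (g : I -> 'rV[int]_r) g0 z :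
  (forall i, i \in s -> Uq_deg (g i) (y i)) -> (forall i, i \in s -> g i != g0) ->
  Uq_deg g0 z -> z = \sum_(i <- s) y i -> z = 0.
Proof.
elim: s y z => [|i s IH] y z dy gy dz; first by rewrite big_nil.
rewrite big_cons => zE.
have [b] : exists b, wchar (rootQ g0) b != wchar (rootQ (g i)) b.
  apply: wchar_sep; try exact: weight_rootQ.
  by rewrite eq_sym (inj_eq (@rootQ_inj _)) gy ?mem_head.
rewrite -subr_eq0 => nz.
pose y' j := (wchar (rootQ (g j)) b - wchar (rootQ (g i)) b) *: y j.
have z'0 : (wchar (rootQ g0) b - wchar (rootQ (g i)) b) *: z = 0.
  apply: (IH y').
  - by move=> j js; apply/Uq_degZ/dy; rewrite in_cons js orbT.
  - by move=> j js; apply: gy; rewrite in_cons js orbT.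
  - exact: Uq_degZ.
  have conjB u v : uK b * (u + v) * uK (- b) = uK b * u * uK (- b) + uK b * v * uK (- b) :> Uq D.
    by rewrite mulrDr mulrDl.
  have conjS (t : seq I) : uK b * (\sum_(j <- t) y j) * uK (- b) =
      \sum_(j <- t) uK b * y j * uK (- b) :> Uq D.
    by rewrite mulr_sumr mulr_suml.
  have dyb j : j \in i :: s -> uK b * y j * uK (- b) = wchar (rootQ (g j)) b *: y j.
    by move=> js; apply: dy.
  have e : wchar (rootQ g0) b *: z =
     wchar (rootQ (g i)) b *: y i + \sum_(j <- s) wchar (rootQ (g j)) b *: y j.
    apply: etrans (esym (dz b)) _; rewrite zE conjB conjS dyb ?mem_head //; congr (_ + _).
    by apply: eq_big_seq => j js; rewrite dyb // in_cons js orbT.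
  rewrite scalerBl e {1}zE scalerDr opprD addrACA subrr add0r scaler_sumr -sumrB.
  by apply: eq_bigr => j _; rewrite -scalerBl.
by apply: (scaler_cancel nz); rewrite z'0 scaler0.
Qed.

Lemma gen_subalg_words (Z : 'I_r -> Uq D) x : gen_subalg (range Z) x ->
  exists s : seq (Qq * seq 'I_r), x = \sum_(p <- s) p.1 *: \prod_(i <- p.2) Z i.
Proof.
elim=> {x} [x [i _ <-]||k x _ [s ->]|x y _ [s ->] _ [t ->]|x y _ [s ->] _ [t ->]].
- by exists [:: (1, [:: i])]; rewrite !big_seq1 scale1r.
- by exists [:: (1, [::])]; rewrite big_seq1 big_nil scale1r.
- exists [seq (k * p.1, p.2) | p <- s]; rewrite big_map scaler_sumr.
  by apply: eq_bigr => p _; rewrite scalerA.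
- by exists (s ++ t); rewrite big_cat.
- exists [seq (p.1 * p'.1, p.2 ++ p'.2) | p <- s, p' <- t].
  rewrite big_allpairs_dep mulr_suml; apply: eq_bigr => p _.
  rewrite mulr_sumr; apply: eq_bigr => p' _.
  by rewrite /= big_cat /= -scalerAl -scalerAr scalerA.
Qed.

Lemma sum_alphaE (s : seq 'I_r) k : (\sum_(j <- s) alpha j : 'rV[int]_r) 0 k = count_mem k s.
Proof.
elim: s => [|j s IH]; first by rewrite big_nil mxE.
by rewrite big_cons mxE IH mxE eqxx /= eq_sym PoszD; congr (_ + _); case: eqP.
Qed.

Lemma sum_alpha_eq (s : seq 'I_r) i : \sum_(j <- s) alpha j = alpha i -> s = [:: i].
Proof.
move=> e; have cnt k : count_mem k s = (k == i).
  have := sum_alphaE s k; rewrite e mxE eqxx /= => h.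
  by apply/eqP; rewrite -eqz_nat -h; case: (k == i).
apply: perm_small_eq => //; apply/allP => k _ /=.
by rewrite cnt addn0 (eq_sym i).
Qed.

(** The sign [sg] treats n^+ and n^- together. After removing the multiples of the one-letter word
    i, only words of other degrees remain, while the difference still has degree alpha_i up to sign;
    so it is zero. *)
Lemma gen_subalg_deg (sg : bool) (Z : 'I_r -> Uq D) x i :
  (forall j, Uq_deg ((-1) ^+ sg *: alpha j) (Z j)) ->
  gen_subalg (range Z) x -> Uq_deg ((-1) ^+ sg *: alpha i) x ->
  exists k : Qq, x = k *: Z i.
Proof.
move=> dZ /gen_subalg_words[s xE] dx.
pose wd (t : seq 'I_r) : 'rV[int]_r := (-1) ^+ sg *: \sum_(j <- t) alpha j.
have dw t : Uq_deg (wd t) (\prod_(j <- t) Z j).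
  rewrite /wd scaler_sumr; elim: t => [|j t IH]; first by rewrite !big_nil; exact: Uq_deg1.
  by rewrite !big_cons; apply: Uq_degM.
have wd_eq t : wd t = (-1) ^+ sg *: alpha i -> t = [:: i].
  move/(congr1 ( *:%R ((-1) ^+ sg))); rewrite !scalerA -signr_addb addbb !scale1r.
  exact: sum_alpha_eq.
pose y (p : Qq * seq 'I_r) := p.1 *: \prod_(j <- p.2) Z j.
exists (\sum_(p <- s | p.2 == [:: i]) p.1).
have e1 : \sum_(p <- s | p.2 == [:: i]) y p = (\sum_(p <- s | p.2 == [:: i]) p.1) *: Z i.
  by rewrite scaler_suml; apply: eq_bigr => p /eqP; rewrite /y => ->; rewrite big_seq1.
rewrite -e1; apply/eqP; rewrite -subr_eq0; apply/eqP.
apply: (@Uq_deg_sum_eq0 _ [seq p <- s | p.2 != [:: i]] y (fun p => wd p.2)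
          ((-1) ^+ sg *: alpha i)).
- by move=> p _; apply/Uq_degZ/dw.
- by move=> p; rewrite mem_filter => /andP[+ _]; apply: contraNneq => /wd_eq ->.
- apply: Uq_degD => //; rewrite -scaleN1r; apply: Uq_degZ; rewrite e1; exact: Uq_degZ.
by rewrite big_filter xE (bigID (fun p => p.2 == [:: i])) /= addrAC subrr add0r.
Qed.

Lemma nplus_deg_alpha x i : Uq_nplus x -> Uq_deg (alpha i) x -> exists k : Qq, x = k *: uE i.
Proof.
move=> nx dx; apply: (gen_subalg_deg (sg := false) _ nx); last by rewrite scale1r.
by move=> j; rewrite scale1r; exact: Uq_deg_uE.
Qed.

Lemma nminus_deg_alpha x i : Uq_nminus x -> Uq_deg (- alpha i) x -> exists k : Qq, x = k *: uF i.
Proof.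
move=> nx dx; apply: (gen_subalg_deg (sg := true) _ nx); last by rewrite scaleN1r.
by move=> j; rewrite scaleN1r; exact: Uq_deg_uF.
Qed.

End Degree.

Section RAlpha.
Variables (D : cartan_datum).
Local Notation r := (rank D).
Variable Delta : {rmorphism Uq D -> UqUq D}.
Hypothesis hDelta : is_coproduct Delta.
Variable Psi : {rmorphism UqUq D -> UqUq D}.
Hypothesis hPsi : is_Psi Psi.
Variable Rp : 'rV[int]_r -> UqUq D.
Hypothesis hRp : is_Rplus Delta Psi Rp.

(** The pieces of n^+ and n^- of degree alpha_i and -alpha_i are spanned by E_i and F_i. Only the
    nonvanishing of k matters later. *)
Lemma Rp_alpha i : exists k, Rp (alpha i) = k *: tpure (uE i) (uF i).
Proof.
have Qa : Qplus (alpha i : 'rV_r) by move=> j; rewrite mxE; case: andP.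
have [/(_ _ Qa)[s [hs ->]] _ _ _] := hRp.
elim: s hs => [|[a b] s IH] hs; first by exists 0; rewrite big_nil scale0r.
have [k kE] := IH (fun p ps => hs p (mem_behead (s := _ :: _) ps)).
have [[/= na da] [nb db]] := hs _ (mem_head _ _).
have [ca ->] := nplus_deg_alpha na da; have [cb ->] := nminus_deg_alpha nb db.
exists (ca * cb + k); rewrite big_cons kE /= tpureZl tpureZr scalerA.
by rewrite scalerDl.
Qed.

Lemma tmulE (a b a' b' : Uq D) :
  tpure a b * tpure a' b' = tpure (a * a') (b * b') :> UqUq D.
Proof. exact: tmul_pure. Qed.

Lemma Delta_uE i : Delta (uE i) = tpure (uE i) (uK (alpha i)) + tpure 1 (uE i).
Proof. by have [_ _ ->] := hDelta. Qed.

Lemma Delta_op_uE i : tflip (Psi (Delta (uE i))) =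
  tpure (uE i) (uK (- alpha i)) + tpure 1 (uE i) :> UqUq D.
Proof.
have [_ [_ /(_ i)[[_ PK] PE _ PE' _]]] := hPsi.
have flipB : bilin (fun a b => tpure b a : UqUq D).
  by split=> [b|a] k x y; [rewrite tpureDr tpureZr | rewrite tpureDl tpureZl].
(* E_i (x) K_i is factored into the two legs on which Psi is prescribed; the K_i^-1 created by Psi
   cancels K_i. *)
have e : Psi (Delta (uE i)) = tpure (uE i) 1 + tpure (uK (- alpha i)) (uE i).
  rewrite Delta_uE rmorphD PE'; congr (_ + _).
  have -> : tpure (uE i) (uK (alpha i)) = tpure (uE i) 1 * tpure 1 (uK (alpha i)) :> UqUq D.
    by rewrite tmulE mulr1 mul1r.
  by rewrite rmorphM PE PK tmulE mulr1 uKNK.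
rewrite e /tflip; have := tlift_linear flipB 1 (tpure (uE i) 1) (tpure (uK (- alpha i)) (uE i)).
by rewrite !scale1r !(tlift_pure _ _ flipB) => ->; rewrite addrC.
Qed.

Lemma tspan_pure (S T : set (Uq D)) a b : S a -> T b -> tspan S T (tpure a b).
Proof.
by move=> Sa Tb; exists [:: (a, b)]; split; [move=> p; rewrite inE => /eqP -> | rewrite big_seq1].
Qed.

(** The relations for R^+ take component families as arguments. This one serves both for Delta(E_i)
    and for its twisted opposite, which consist of a piece of first degree alpha_i and a piece of
    first degree 0. *)
Definition two_parts i (u w : UqUq D) (g : 'rV[int]_r) : UqUq D :=
  if g == alpha i then u else if g == 0 then w else 0.

Lemma leg1_two_parts i (a b c d : Uq D) : Uq_deg (alpha i) a -> Uq_deg 0 c ->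
  leg1_components (tpure a b + tpure c d) (two_parts i (tpure a b) (tpure c d)).
Proof.
move=> da dc; have out g : g \notin [:: alpha i; 0] ->
    two_parts i (tpure a b) (tpure c d) g = 0.
  by rewrite !inE negb_or /two_parts => /andP[/negPf -> /negPf ->].
split.
- move=> g; rewrite /two_parts.
  case: eqP => [->|_]; first exact: tspan_pure.
  case: eqP => [->|_]; first exact: tspan_pure.
  by exists [::]; rewrite big_nil.
- apply: (@sub_finite_set _ _ [set` [:: alpha i; 0]]); last exact: finite_seq.
  by move=> g /=; apply: contraNT => /out ->.
rewrite (fsbigE [:: alpha i; 0]) //.
- rewrite big_mkcond !big_cons big_nil !in_setT /two_parts eqxx [0 == _]eq_sym.
  rewrite (negPf (alpha_neq0 i)) eqxx /=.
  by rewrite addr0.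
- by rewrite /= inE alpha_neq0.
by move=> g _ /out.
Qed.

Lemma Qplus_le_alpha (i : 'I_r) nu : Qplus_le (alpha i) nu -> nu \in [:: 0; alpha i].
Proof.
move=> [Qnu Qd]; have nuj j : j != i -> nu 0 j = 0.
  move=> ji; apply/eqP; rewrite eq_le Qnu andbT.
  by have := Qd j; rewrite !mxE eqxx (negPf ji) add0r oppr_ge0.
have : nu 0 i = 0 \/ nu 0 i = 1.
  have := Qnu i; have := Qd i; rewrite !mxE !eqxx /= subr_ge0.
  by case: (nu 0 i) => // -[|[|k]] // _ _; [left|right].
rewrite !inE => -[e|e].
  apply/orP; left; apply/eqP/rowP => j; rewrite mxE.
  by have [->|/nuj] := eqVneq j i.
apply/orP; right; apply/eqP/rowP => j; rewrite mxE eqxx /=.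
by have [->|/nuj] := eqVneq j i.
Qed.

(* The degree alpha_i part of R^+ Delta(E_i) = Delta_Psi^op(E_i) R^+. *)
Lemma Rp_alpha_rel i :
  tpure (uE i) (uK (alpha i)) - tpure (uE i) (uK (- alpha i))
  + (Rp (alpha i) * tpure 1 (uE i) - tpure 1 (uE i) * Rp (alpha i)) = 0 :> UqUq D.
Proof.
have Qa : Qplus (alpha i : 'rV_r) by move=> j; rewrite mxE; case: andP.
have [_ R0 /(_ (alpha i) (uE i)) rel _] := hRp.
have c1 := leg1_two_parts (uK (alpha i)) (uE i) (Uq_deg_uE i) (@Uq_deg1 D).
have c2 := leg1_two_parts (uK (- alpha i)) (uE i) (Uq_deg_uE i) (@Uq_deg1 D).
rewrite -Delta_uE in c1; rewrite -Delta_op_uE in c2.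
have bE : Uq_bplus (uE i : Uq D) by apply: gen_subalg_gen; left; exists i.
have := rel _ _ Qa bE c1 c2.
(* Below alpha_i there are only nu = 0, giving E_i (x) (K_i - K_i^-1), and nu = alpha_i, giving the
   commutator with 1 (x) E_i. *)
rewrite (fsbigE [:: 0; alpha i]) //; first last.
- by move=> nu /Qplus_le_alpha ->.
- move=> nu /=; rewrite !inE => /orP[] /eqP ->; split=> //; try by move=> j; rewrite mxE.
    by rewrite subr0.
  by rewrite subrr => j; rewrite mxE.
- by rewrite /= inE eq_sym alpha_neq0.
rewrite big_mkcond !big_cons big_nil !mem_set; first last.
- by split=> // j; rewrite ?subr0 ?mxE.
- by split=> //; rewrite subrr => j; rewrite mxE.
rewrite subr0 subrr R0 /two_parts eqxx [0 == _]eq_sym (negPf (alpha_neq0 i)) eqxx /=.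
by rewrite mul1r mulr1 addr0.
Qed.

End RAlpha.

(** * The elements xi *)

Section CommutingElements.
Variable A : pzRingType.
Implicit Types x y z : A.

Lemma ring_invP x : (exists y, x * y = 1 /\ y * x = 1) ->
  x * ring_inv x = 1 /\ ring_inv x * x = 1.
Proof. by move=> ex; exact: (@xgetPex _ 0 [set y | x * y = 1 /\ y * x = 1] ex). Qed.

Lemma comm_ring_inv x y : (exists y, x * y = 1 /\ y * x = 1) ->
  GRing.comm x y -> GRing.comm (ring_inv x) y.
Proof.
move=> /ring_invP[xV Vx] xy; rewrite /GRing.comm.
by rewrite -[LHS]mulr1 -xV mulrA -(mulrA _ y x) -xy mulrA Vx mul1r.
Qed.

(** The exponent [i \in s] lets the induction pass through sublists that miss i; where i occurs, its
    extra factor commutes past the rest. *)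
Lemma prod_expr_comm (I : eqType) (s : seq I) (x : I -> A) (b : I -> nat) i :
  (forall j k, GRing.comm (x j) (x k)) -> uniq s ->
  \prod_(j <- s) x j ^+ (b j + (j == i)) = (\prod_(j <- s) x j ^+ b j) * x i ^+ (i \in s).
Proof.
move=> xC; elim: s => [|j s IH] /=; first by rewrite !big_nil mulr1.
move=> /andP[js us]; rewrite !big_cons IH // in_cons (eq_sym i).
have [<-|_] := eqVneq j i; last by rewrite addn0 mulrA.
rewrite (negPf js) mulr1 exprD !expr1 -!mulrA; congr (_ * _).
by apply: commr_prod => k _; exact: commrX.
Qed.

End CommutingElements.

Section XiElements.
Variable D : cartan_datum.
Local Notation r := (rank D).
Variables (Delta : {rmorphism Uq D -> UqUq D}) (hDelta : is_coproduct Delta).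
Variables (Psi : {rmorphism UqUq D -> UqUq D}) (hPsi : is_Psi Psi).
Variables (Rp : 'rV[int]_r -> UqUq D) (hRp : is_Rplus Delta Psi Rp).
Variable lam : 'rV[rat]_r.
Variables (n : nat) (pi : {lrmorphism Uq D -> 'M[Qq]_n.+1}).
Hypothesis pi_type1 : type1_module pi.
Variables (mp mm : nat) (Xp : mp.-tuple 'M[Qq]_n.+1) (Xm : mm.-tuple 'M[Qq]_n.+1).
Hypothesis hXp : basis_of_sum pi (@Qplus D) Xp.
Variable ell : 'rV[rat]_r -> UR pi (Rmx pi lam Rp) Xp Xm.
Hypothesis hell : is_ell ell.
Local Notation P := (wproj pi).

Lemma tensmx_eqr m p (A : 'M[Qq]_m) (B C : 'M[Qq]_p) : A != 0 -> A *t B = A *t C -> B = C.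
Proof.
move=> /mx_neq0_entry[i [j Aij]] e; apply/matrixP => k l; apply: (mulfI Aij).
by have /matrixP/(_ (mxtens_index (i, k)) (mxtens_index (j, l))) := e; rewrite !tensmxE.
Qed.

(** If K_i and K_i^-1 acted alike, all weights would be zero on the coroot of alpha_i, yet mu and mu
    + alpha_i differ there by 2. *)
Lemma wt_succ_K_neq i mu : wt_succ pi i mu -> pi (uK (alpha i)) != pi (uK (- alpha i)).
Proof.
move=> [wtmu wtmu']; apply/eqP => KK.
have wcharE ga : wt pi ga -> wchar ga (alpha i) = wchar ga (- alpha i).
  case=> _ [w w0 hw]; apply/eqP; rewrite -subr_eq0.
  have : (wchar ga (alpha i) - wchar ga (- alpha i)) *: w = 0.
    by rewrite scalerBl -!hw KK subrr.
  by move/eqP; rewrite scaler_eq0 (negPf w0) orbF.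
have orth ga (m : int) : wt pi ga -> form ga (rootQ (alpha i)) = (m * (dlen i)%:Z)%:~R -> m = 0.
  move=> /wcharE e /wchar_alpha[e1 e2]; apply/eqP/negPn/negP => /(expqi_diff_neq0 i).
  by rewrite -e1 -e2 e subrr eqxx.
have [m fm] := weight_alpha_int i (wt_lattice wtmu).
have m0 := orth _ _ wtmu fm.
have := (form_shift 1 fm).1; rewrite mulr1n => /(orth _ _ wtmu').
by rewrite m0.
Qed.

(** For k = 0 the degree alpha_i relation collapses to E_i (x) K_i = E_i (x) K_i^-1, which fails on
    V (x) V. *)
Lemma Rp_alpha_neq0 i mu k : wt_succ pi i mu ->
  Rp (alpha i) = k *: tpure (uE i) (uF i) -> k != 0.
Proof.
move=> wi Rk; apply/eqP => k0; rewrite k0 scale0r in Rk.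
have rel := Rp_alpha_rel hDelta hPsi hRp i.
rewrite Rk mul0r mulr0 subrr addr0 in rel.
have E0 : pi (uE i) != 0.
  by have [+ _] := wt_succ_EF pi_type1 wi; apply: contraNneq => ->; rewrite mulmx0 mul0mx.
have /eqP := wt_succ_K_neq wi; apply; apply: (tensmx_eqr E0).
rewrite -!pi2_pure; congr (tlift _ _).
by apply/eqP; rewrite -subr_eq0; apply/eqP.
Qed.

Lemma ell_comm mu ga : wt pi mu -> wt pi ga -> GRing.comm (ell mu) (ell ga).
Proof.
move=> wtmu wtga; have [_ R0 _ _] := hRp.
have pi1 : pi 1 = 1%:M by rewrite rmorph1.
have P1 ka : wt pi ka -> P ka *m pi 1 *m P ka != 0.
  move=> wtka; rewrite pi1 mulmx1 wproj_idem //; [exact: wproj_neq0|].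
  exact: wt_lattice wtka.
have := @ell_exchange _ _ _ lam _ _ _ pi_type1 hRp _ _ Xp Xm hXp ell hell 0 1 1 1 mu ga.
rewrite rootQ0 !addr0 subr0 oppr0; apply=> //; try exact: P1; try exact: Uq_deg1.
- by move=> j; rewrite mxE.
- by rewrite R0 scale1r -pi2_pure.
exact: oner_neq0.
Qed.

(** The exchange at nu0 = alpha_i tests E_i on V_mu and F_i on V_(mu0 + alpha_i) separately, so the
    two weights may be chosen independently. *)
Lemma ell_alpha i mu mu0 : wt_succ pi i mu -> wt_succ pi i mu0 ->
  ell mu * ell (mu0 + rootQ (alpha i)) = ell mu0 * ell (mu + rootQ (alpha i)).
Proof.
move=> wi wi0; have [k Rk] := Rp_alpha hRp i.
have [[wtmu wtmu'] [wt0 wt0']] := (wi, wi0).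
have := @ell_exchange _ _ _ lam _ _ _ pi_type1 hRp _ _ Xp Xm hXp ell hell
  (alpha i) k (uE i) (uF i) mu (mu0 + rootQ (alpha i)).
rewrite addrK; apply=> //.
- by move=> j; rewrite mxE; case: andP.
- exact: Uq_deg_uE.
- exact: Uq_deg_uF.
- rewrite Rk -tpureZl pi2_pure piZ; apply/matrixP => x y.
  by rewrite !mxE mulrA.
- exact: Rp_alpha_neq0 wi Rk.
- exact: (wt_succ_EF pi_type1 wi).1.
exact: (wt_succ_EF pi_type1 wi0).2.
Qed.

Lemma xi_indep i mu mu0 : wt_succ pi i mu -> wt_succ pi i mu0 ->
  ring_inv (ell (mu + rootQ (alpha i))) * ell mu =
  ring_inv (ell (mu0 + rootQ (alpha i))) * ell mu0.
Proof.
move=> wi wi0; have e := ell_alpha wi wi0.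
have [[wtmu wtmu'] [wt0 wt0']] := (wi, wi0).
have un ga (wtga : wt pi ga) := ell_unit pi_type1 hell wtga.
have [uV Vu] := ring_invP (un _ wtmu'); have [vV Vv] := ring_invP (un _ wt0').
set u := ell mu in e *; set u' := ell (mu + _) in e uV Vu *.
set v := ell mu0 in e *; set v' := ell (mu0 + _) in e vV Vv *.
have c1 : GRing.comm (ring_inv u') u by apply: comm_ring_inv (un _ wtmu') (ell_comm wtmu' wtmu).
have c2 : GRing.comm (ring_inv v') u by apply: comm_ring_inv (un _ wt0') (ell_comm wt0' wtmu).
(* The product u' u'^-1 is inserted after v, so that v u' can be replaced by u v'. *)
rewrite c1 -[ring_inv v' * v]mulr1 -uV mulrA -(mulrA _ v u') -e mulrA c2.
by rewrite -(mulrA u) Vv mulr1.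
Qed.

Lemma ell_succ (x : UR pi (Rmx pi lam Rp) Xp Xm) i mu : wt_succ pi i mu ->
  x = ring_inv (ell (mu + rootQ (alpha i))) * ell mu -> ell mu = ell (mu + rootQ (alpha i)) * x.
Proof.
move=> [_ wtmu'] ->; have [uV _] := ring_invP (ell_unit pi_type1 hell wtmu').
by rewrite mulrA uV mul1r.
Qed.

(** Allows a new factor to be absorbed at its place in the ordered product of the xi_j. *)
Lemma xi_comm i j mu mu0 : wt_succ pi i mu -> wt_succ pi j mu0 ->
  GRing.comm (ring_inv (ell (mu + rootQ (alpha i))) * ell mu)
             (ring_inv (ell (mu0 + rootQ (alpha j))) * ell mu0).
Proof.
move=> [wtmu wtmu'] [wt0 wt0'].
have c ga de : wt pi ga -> wt pi de ->
    GRing.comm (ell ga) (ell de) /\ GRing.comm (ring_inv (ell ga)) (ell de).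
  by move=> wg wd; split; [|apply: comm_ring_inv (ell_unit pi_type1 hell wg) _]; exact: ell_comm.
have cV ga de : wt pi ga -> wt pi de -> GRing.comm (ring_inv (ell ga)) (ring_inv (ell de)).
  move=> wg wd; apply: comm_ring_inv (ell_unit pi_type1 hell wg) _.
  by apply/commr_sym/(c _ _ wd wg).2.
apply: commrM; apply: commr_sym; apply: commrM; apply: commr_sym.
- exact: cV.
- exact/commr_sym/(c _ _ wt0' wtmu).2.
- exact: (c _ _ wtmu' wt0).2.
- exact: (c _ _ wtmu wt0).1.
Qed.

End XiElements.

Theorem corollary4p9
  (D : cartan_datum)
  (Delta : {rmorphism Uq D -> UqUq D}) (hDelta : is_coproduct Delta)
  (Psi : {rmorphism UqUq D -> UqUq D}) (hPsi : is_Psi Psi)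
  (Rp : 'rV[int]_(rank D) -> UqUq D) (hRp : is_Rplus Delta Psi Rp)
  (lam : 'rV[rat]_(rank D)) (lam_dom : dominant lam) (lam_neq0 : lam != 0)
  (n : nat) (pi : {lrmorphism Uq D -> 'M[Qq]_n.+1})
  (pi_irr : irreducible_module pi) (pi_type1 : type1_module pi)
  (pi_hw : has_highest_weight pi lam)
  (mp mm : nat) (Xp : mp.-tuple 'M[Qq]_n.+1) (Xm : mm.-tuple 'M[Qq]_n.+1)
  (hXp : basis_of_sum pi (@Qplus D) Xp) (hXm : basis_of_sum pi (@Qminus D) Xm)
  (ell : 'rV[rat]_(rank D) -> UR pi (Rmx pi lam Rp) Xp Xm)
  (hell : is_ell ell) :
  (forall i : 'I_(rank D), exists! x : UR pi (Rmx pi lam Rp) Xp Xm,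
     forall mu, wt_succ pi i mu ->
       x = ring_inv (ell (mu + rootQ (alpha i))) * ell mu) /\
  (forall xi : 'I_(rank D) -> UR pi (Rmx pi lam Rp) Xp Xm,
     (forall i mu, wt_succ pi i mu ->
        xi i = ring_inv (ell (mu + rootQ (alpha i))) * ell mu) ->
     forall mu (b : 'I_(rank D) -> nat), wt pi mu ->
       lam - mu = \sum_j (b j)%:R *: rootQ (alpha j) ->
       ell mu = ell lam * \prod_j xi j ^+ b j).
Proof.
have succ i := wt_succ_nonempty lam_dom lam_neq0 pi_hw i.
have indep := xi_indep hDelta hPsi hRp pi_type1 hXp hell.
split=> [i|xi hxi mu b wtmu muE].
  have [mu0 wi0] := succ i.
  exists (ring_inv (ell (mu0 + rootQ (alpha i))) * ell mu0); split.
    by move=> mu wi; apply: indep.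
  by move=> x /(_ _ wi0) ->.
have xiC i j : GRing.comm (xi i) (xi j).
  have [[mui wi] [muj wj]] := (succ i, succ j).
  rewrite (hxi _ _ wi) (hxi _ _ wj).
  exact: (xi_comm hRp pi_type1 hXp hell wi wj).
have [v [v0 hv Ev]] := pi_hw.
(* A nonzero word has nonzero tails, so removing its first letter stays within the weights of V and
   each letter i is one use of the defining property of xi_i. *)
have ellw s : word pi v s != 0 -> wt pi (word_weight lam s) /\
    ell (word_weight lam s) = ell lam * \prod_j xi j ^+ count_mem j s.
  elim: s => [|i s IH] ws0.
    have -> : word_weight lam [::] = lam by rewrite /word_weight big_nil rootQ0 subr0.
    by split; [exact: (wt_highest lam_dom pi_hw) | rewrite big1 ?mulr1].
  have ws : word pi v s != 0 by apply: contraNneq ws0 => /= ->; rewrite mulmx0.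
  have [wts ells] := IH ws.
  have wti : wt pi (word_weight lam (i :: s)).
    exact: neq0_wt (weight_lattice_word lam_dom _) (word_wspace lam_dom hv _) ws0.
  have back : word_weight lam (i :: s) + rootQ (alpha i) = word_weight lam s.
    by rewrite word_weight_cons rootQN subrK.
  have wi : wt_succ pi i (word_weight lam (i :: s)) by split; rewrite ?back.
  split=> //; rewrite (ell_succ pi_type1 hell wi (hxi _ _ wi)) back ells -mulrA; congr (_ * _).
  have := @prod_expr_comm _ _ (index_enum 'I_(rank D)) xi (fun j => count_mem j s) i xiC.
  rewrite mem_index_enum index_enum_uniq expr1 => <- //.
  by apply: eq_bigr => j _ /=; rewrite addnC eq_sym.
have [s muw ws0] := wt_word pi_type1 lam_dom v0 hv Ev pi_irr wtmu.
rewrite muw (ellw s ws0).2; congr (_ * _); apply: eq_bigr => j _; congr (_ ^+ _).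
(* Comparing coordinates in the simple roots identifies b_j with the number of letters j in the
   word. *)
move: muE; rewrite muw /word_weight opprB addrCA subrr addr0 => /rowP/(_ j).
rewrite mxE sum_alphaE summxE (bigD1 j) //= big1 => [|k /negPf kj].
  by rewrite addr0 !mxE !eqxx mulr1 => /eqP; rewrite eqr_nat => /eqP.
by rewrite !mxE eq_sym kj mulr0.
Qed.
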